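(* Let $M$ be a simple infinite-dimensional $\mathfrak g$-module that is finitely generated as a $U(\mathfrak h)$-module. Then $M$ is torsion free as a $U(\mathfrak h)$-module.
   Context: $\mathfrak g$ is a finite-dimensional simple complex Lie algebra, $\mathfrak h$ a Cartan subalgebra of $\mathfrak g$, and $U(\mathfrak h)$ its universal enveloping algebra. *)

(* Defs.v *)
From HB Require Import structures.
From mathcomp Require Import all_boot all_order all_algebra.
From mathcomp Require Import generic_quotient ring_quotient.
From mathcomp Require Import finmap monalg.
From mathcomp Require Import complex boolp reals.

Set Implicit Arguments.
Unset Strict Implicit.
Unset Printing Implicit Defensive.

Import GRing.Theory.
Local Open Scope ring_scope.
Local Open Scope quotient_scope.

(** * Lie algebras *)

HB.mixin Record Lmodule_isLie (K : fieldType) L of GRing.Lmodule K L := {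
  bracket : L -> L -> L;
  bracket_linearl : forall y : L, linear (bracket ^~ y);
  bracket_linearr : forall x : L, linear (bracket x);
  bracketxx : forall x : L, bracket x x = 0;
  bracket_jacobi : forall x y z : L,
    bracket x (bracket y z) + bracket y (bracket z x)
      + bracket z (bracket x y) = 0
}.

#[short(type="lieAlgType")]
HB.structure Definition LieAlgebra (K : fieldType) :=
  {L of GRing.Lmodule K L & Lmodule_isLie K L}.

#[short(type="finLieAlgType")]
HB.structure Definition FinLieAlgebra (K : fieldType) :=
  {L of LieAlgebra K L & Vector K L}.

Section FiniteDimensional.
Variables (K : fieldType) (g : finLieAlgType K).
Implicit Types U V I : {vspace g}.

(* By bilinearity, the brackets of basis vectors span the same subspace as all
   the brackets [x, y] with x in U and y in V. *)
Definition bracketv U V : {vspace g} :=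
  <<[seq bracket x y | x <- vbasis U, y <- vbasis V]>>%VS.

Definition lower_central U (n : nat) : {vspace g} := iter n (bracketv U) U.

Definition nilpotent_lie U := exists n, lower_central U n = 0%VS.

Definition self_normalizing U :=
  forall x, (forall y, y \in U -> bracket x y \in U) -> x \in U.

Definition lie_ideal I := forall x y, y \in I -> bracket x y \in I.

Definition simple_lie :=
  (exists x y : g, bracket x y != 0) /\
  (forall I, lie_ideal I -> I = 0%VS \/ I = fullv).

Record lieSubalg := LieSubalg {
  lieSubalg_vspace :> {vspace g};
  lieSubalg_bracket : forall x y, x \in lieSubalg_vspace ->
    y \in lieSubalg_vspace -> bracket x y \in lieSubalg_vspace
}.

Definition cartan_subalgebra (h : lieSubalg) :=
  nilpotent_lie h /\ self_normalizing h.

Section Subalgebra.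
Variable h : lieSubalg.
Implicit Types x y z : subvs_of h.

Fact sub_bracket_subproof x y : bracket (vsval x) (vsval y) \in (h : {vspace g}).
Proof. exact: lieSubalg_bracket (subvsP x) (subvsP y). Qed.

Definition sub_bracket x y : subvs_of h := Subvs (sub_bracket_subproof x y).

Fact sub_bracket_linearl y : linear (sub_bracket ^~ y).
Proof. by move=> a u v; apply/val_inj/(bracket_linearl (vsval y)). Qed.

Fact sub_bracket_linearr x : linear (sub_bracket x).
Proof. by move=> a u v; apply/val_inj/(bracket_linearr (vsval x)). Qed.

Fact sub_bracketxx x : sub_bracket x x = 0.
Proof. by apply/val_inj/bracketxx. Qed.

Fact sub_bracket_jacobi x y z :
  sub_bracket x (sub_bracket y z) + sub_bracket y (sub_bracket z x)
    + sub_bracket z (sub_bracket x y) = 0.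
Proof. by apply/val_inj/bracket_jacobi. Qed.

HB.instance Definition _ := Lmodule_isLie.Build K (subvs_of h)
  sub_bracket_linearl sub_bracket_linearr sub_bracketxx sub_bracket_jacobi.

End Subalgebra.
End FiniteDimensional.

(** * Modules over a Lie algebra *)

HB.mixin Record Lmodule_isLieModule (K : fieldType) (L : lieAlgType K) M
    of GRing.Lmodule K M := {
  lact : L -> M -> M;
  lact_linearl : forall m : M, linear (lact ^~ m);
  lact_linearr : forall x : L, linear (lact x);
  lact_bracket : forall (x y : L) (m : M),
    lact (bracket x y) m = lact x (lact y m) - lact y (lact x m)
}.

#[short(type="lieModType")]
HB.structure Definition LieModule (K : fieldType) (L : lieAlgType K) :=
  {M of GRing.Lmodule K M & Lmodule_isLieModule K L M}.

Section SimpleModule.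
Variables (K : fieldType) (L : lieAlgType K) (M : lieModType L).

Definition lie_submodule (N : M -> Prop) :=
  [/\ N 0, forall (a : K) u v, N u -> N v -> N (a *: u + v)
    & forall (x : L) u, N u -> N (lact x u)].

Definition simple_lie_module :=
  (exists m : M, m != 0) /\
  (forall N, lie_submodule N -> (forall m, N m -> m = 0) \/ (forall m, N m)).

End SimpleModule.

(* M with the action restricted to h. *)
Definition resMod (K : fieldType) (g : finLieAlgType K) (h : lieSubalg g)
  (M : lieModType g) : Type := M.

Section Restriction.
Variables (K : fieldType) (g : finLieAlgType K) (h : lieSubalg g).
Variable M : lieModType g.

HB.instance Definition _ := GRing.Lmodule.copy (resMod h M) M.

Definition res_act (x : subvs_of h) (m : resMod h M) : resMod h M :=
  lact (vsval x) (m : M).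

Fact res_act_linearl m : linear (res_act ^~ m).
Proof. by move=> a x y; apply: (lact_linearl (m : M)). Qed.

Fact res_act_linearr x : linear (res_act x).
Proof. by move=> a u v; apply: (lact_linearr (s := M) (vsval x)). Qed.

Fact res_act_bracket x y m :
  res_act (bracket x y) m = res_act x (res_act y m) - res_act y (res_act x m).
Proof. exact: (lact_bracket (vsval x) (vsval y) (m : M)). Qed.

HB.instance Definition _ :=
  Lmodule_isLieModule.Build K (subvs_of h : lieAlgType K) (resMod h M)
    res_act_linearl res_act_linearr res_act_bracket.

End Restriction.

(** * The universal enveloping algebra *)

Section EnvelopingAlgebra.
Variables (K : fieldType) (L : lieAlgType K).

(* The free associative algebra on the underlying set of L. Dividing it by the
   relations [gen (a x + y) = a gen x + gen y] gives the tensor algebra T(L),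
   and dividing further by [gen x gen y - gen y gen x = gen [x, y]] gives
   U(L). Both families are imposed at once in [uenv_rel] below. *)
Local Notation free_alg := {malg K[{fmonom L}]}.

Definition fgen (x : L) : free_alg := << fmu x >>.

Inductive uenv_rel : free_alg -> Prop :=
| uenv_rel_linear a x y :
    uenv_rel (fgen (a *: x + y) - (a *: fgen x + fgen y))
| uenv_rel_bracket x y :
    uenv_rel (fgen x * fgen y - fgen y * fgen x - fgen (bracket x y))
| uenv_rel_sub p q : uenv_rel p -> uenv_rel q -> uenv_rel (p - q)
| uenv_rel_mull p q : uenv_rel q -> uenv_rel (p * q)
| uenv_rel_mulr p q : uenv_rel p -> uenv_rel (p * q).

Definition uenv_ideal : {pred free_alg} := fun p => `[< uenv_rel p >].

Lemma uenv_idealP p : reflect (uenv_rel p) (p \in uenv_ideal).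
Proof. exact: asboolP. Qed.

Fact uenv_ideal_zmod : zmod_closed uenv_ideal.
Proof.
split=> [|p q /uenv_idealP hp /uenv_idealP hq]; apply/uenv_idealP.
  have h := uenv_rel_bracket 0 0; by rewrite -(subrr (fgen 0 * fgen 0 -
    fgen 0 * fgen 0 - fgen (bracket 0 0))); apply: uenv_rel_sub.
exact: uenv_rel_sub.
Qed.

HB.instance Definition _ :=
  GRing.isZmodClosed.Build free_alg uenv_ideal uenv_ideal_zmod.

Definition uenv : Type := {ideal_quot (uenv_ideal : zmodClosed free_alg)}.

HB.instance Definition _ := GRing.Zmodule.on uenv.

Definition upi (p : free_alg) : uenv := \pi_{ideal_quot uenv_ideal} p.
Definition urepr (u : uenv) : free_alg :=
  repr (u : {ideal_quot (uenv_ideal : zmodClosed free_alg)}).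

Lemma ureprK u : upi (urepr u) = u.
Proof. exact: reprK. Qed.

Lemma upiP p q : reflect (upi p = upi q) (p - q \in uenv_ideal).
Proof. by rewrite Quotient.idealrBE; apply: eqP. Qed.

Lemma upi_rel p q : upi p = upi q <-> uenv_rel (p - q).
Proof.
split=> [/upiP/uenv_idealP //|h]; exact/upiP/uenv_idealP.
Qed.

Lemma upiD p q : upi (p + q) = upi p + upi q.
Proof. by rewrite /upi; apply: Quotient.pi_add. Qed.

Lemma upi_reprB p : uenv_rel (urepr (upi p) - p).
Proof. by apply/upi_rel; rewrite ureprK. Qed.

Lemma uenv_relD p q : uenv_rel p -> uenv_rel q -> uenv_rel (p + q).
Proof.
move=> /uenv_idealP hp /uenv_idealP hq; apply/uenv_idealP; exact: rpredD.
Qed.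

Definition uone : uenv := upi 1.
Definition umul (u v : uenv) : uenv := upi (urepr u * urepr v).
Definition uscale (a : K) (u : uenv) : uenv := upi (a *: urepr u).

Lemma upiM p q : upi (p * q) = umul (upi p) (upi q).
Proof.
apply/esym/upi_rel; rewrite -[_ * _](addrNK (p * urepr (upi q))) -mulrBl -addrA.
rewrite -mulrBr; apply: uenv_relD.
  exact/uenv_rel_mulr/upi_reprB.
exact/uenv_rel_mull/upi_reprB.
Qed.

Lemma upiZ a p : upi (a *: p) = uscale a (upi p).
Proof.
apply/esym/upi_rel; rewrite -scalerBr -mul_malgC.
exact/uenv_rel_mull/upi_reprB.
Qed.

Fact umulA : associative umul.
Proof.
by move=> u v w; rewrite -[u]ureprK -[v]ureprK -[w]ureprK -!upiM mulrA.
Qed.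

Fact umul1l : left_id uone umul.
Proof. by move=> u; rewrite -[u]ureprK -upiM mul1r. Qed.

Fact umul1r : right_id uone umul.
Proof. by move=> u; rewrite -[u]ureprK -upiM mulr1. Qed.

Fact umulDl : left_distributive umul +%R.
Proof.
move=> u v w; rewrite -[u]ureprK -[v]ureprK -[w]ureprK.
by rewrite -upiD -!upiM -upiD mulrDl.
Qed.

Fact umulDr : right_distributive umul +%R.
Proof.
move=> u v w; rewrite -[u]ureprK -[v]ureprK -[w]ureprK.
by rewrite -upiD -!upiM -upiD mulrDr.
Qed.

(* The augmentation, i.e. the constant coefficient, kills the relations. *)
Lemma uenv_rel_aug p : uenv_rel p -> p@_mone = 0.
Proof.
have gen0 x : (fgen x)@_mone = 0 :> K.
  by rewrite mcoeffU1; case: eqP => // /(congr1 (@fdeg L)); rewrite fdegU fdeg1.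
have augM q r : (q * r)@_mone = q@_mone * r@_mone :> K.
  exact: (mcoeff1g_is_multiplicative _ _).1.
elim=> [a x y|x y|q r _ hq _ hr|q r _ hr|q r _ hq].
- by rewrite mcoeffB mcoeffD mcoeffZ !gen0 mulr0 addr0 subr0.
- by rewrite !mcoeffB !augM !gen0 mul0r !subr0.
- by rewrite mcoeffB hq hr subr0.
- by rewrite augM hr mulr0.
- by rewrite augM hq mul0r.
Qed.

Fact uone_neq0 : uone != 0.
Proof.
have <- : upi 0 = 0 by apply: (addIr (upi 0)); rewrite -upiD !add0r.
apply/eqP => /upi_rel /uenv_rel_aug; rewrite subr0 mcoeff1 eqxx => /eqP.
by rewrite oner_eq0.
Qed.

HB.instance Definition _ := GRing.Zmodule_isNzRing.Build uenv
  umulA umul1l umul1r umulDl umulDr uone_neq0.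

Fact uscaleA a b u : uscale a (uscale b u) = uscale (a * b) u.
Proof. by rewrite -[u]ureprK -!upiZ scalerA. Qed.

Fact uscale1 : left_id 1 uscale.
Proof. by move=> u; rewrite -[u]ureprK -upiZ scale1r. Qed.

Fact uscaleDr : right_distributive uscale +%R.
Proof.
move=> a u v; rewrite -[u]ureprK -[v]ureprK.
by rewrite -upiD -!upiZ -upiD scalerDr.
Qed.

Fact uscaleDl u : {morph uscale^~ u : a b / a + b}.
Proof. by move=> a b; rewrite -[u]ureprK -!upiZ -upiD scalerDl. Qed.

HB.instance Definition _ := GRing.Zmodule_isLmodule.Build K uenv
  uscaleA uscale1 uscaleDr uscaleDl.

Fact uscaleAl (a : K) (u v : uenv) : a *: (u * v) = (a *: u) * v.
Proof.
rewrite -[u]ureprK -[v]ureprK.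
rewrite -[upi _ * upi _]upiM -[LHS]upiZ -[a *: _]upiZ -[RHS]upiM.
by rewrite scalerAl.
Qed.

HB.instance Definition _ := GRing.Lmodule_isLalgebra.Build K uenv uscaleAl.

Fact free_alg_scalerAr (a : K) (p q : free_alg) : a *: (p * q) = p * (a *: q).
Proof.
suff comm : p * a%:MP = a *: p by rewrite -[a *: q]mul_malgC mulrA comm scalerAl.
rewrite malgM_def fgmulgU malgZ_def.
by apply: eq_bigr => k _; rewrite mulm1 mulrC.
Qed.

Fact uscaleAr (a : K) (u v : uenv) : a *: (u * v) = u * (a *: v).
Proof.
rewrite -[u]ureprK -[v]ureprK.
rewrite -[upi _ * upi _]upiM -[LHS]upiZ -[a *: _]upiZ -[RHS]upiM.
by rewrite free_alg_scalerAr.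
Qed.

HB.instance Definition _ := GRing.Lalgebra_isAlgebra.Build K uenv uscaleAr.

Definition uiota (x : L) : uenv := upi (fgen x).

Fact uiota_linear : linear uiota.
Proof.
move=> a x y; rewrite -[a *: uiota x]upiZ -upiD; apply/upi_rel.
exact: uenv_rel_linear.
Qed.

Fact uiota_bracket x y :
  uiota (bracket x y) = uiota x * uiota y - uiota y * uiota x.
Proof.
rewrite -[uiota x * _]upiM -[uiota y * _]upiM; apply/eqP; rewrite eq_sym subr_eq.
rewrite -upiD; apply/eqP/upi_rel; rewrite opprD addrA addrAC.
exact: uenv_rel_bracket.
Qed.

End EnvelopingAlgebra.

Section EnvelopingModule.
Variables (K : fieldType) (L : lieAlgType K) (M : lieModType L).
Local Notation free_alg := {malg K[{fmonom L}]}.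
Implicit Types (p q : free_alg) (w : {fmonom L}) (u v : uenv L) (m n : M).

(* The word x1 x2 ... xk acts by m |-> x1 (x2 (... (xk m))). *)
Definition word_act w m : M := foldr lact m (w : seq L).

Definition free_act p m : M := \sum_(w <- msupp p) p@_w *: word_act w m.

Definition uact u m : M := free_act (urepr u) m.

Lemma word_act_linear w : linear (word_act w).
Proof.
move=> a m n; rewrite /word_act; elim: (w : seq L) => //= x s ->.
exact: lact_linearr.
Qed.

Lemma free_actEw p m (d : {fset {fmonom L}}) : (msupp p `<=` d)%fset ->
  free_act p m = \sum_(w <- d) p@_w *: word_act w m.
Proof.
move=> le; rewrite /free_act (big_fset_incl _ le) //= => w _ /mcoeff_outdom ->.
by rewrite scale0r.
Qed.

Lemma free_actU a w m : free_act << a *g w >> m = a *: word_act w m.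
Proof. by rewrite (free_actEw _ msuppU_le) big_seq_fset1 mcoeffUU. Qed.

Lemma free_act_linearl m : linear (free_act ^~ m).
Proof.
move=> a p q; pose d := (msupp p `|` msupp q)%fset.
have hp : (msupp p `<=` d)%fset by exact: fsubsetUl.
have hq : (msupp q `<=` d)%fset by exact: fsubsetUr.
have hpq : (msupp (a *: p + q) `<=` d)%fset.
  apply: fsubset_trans (msuppD_le _ _) _; apply: fsetSU; exact: msuppZ_le.
rewrite (free_actEw _ hp) (free_actEw _ hq) (free_actEw _ hpq) scaler_sumr.
rewrite -big_split /=; apply: eq_bigr => w _.
by rewrite mcoeffD mcoeffZ scalerDl scalerA.
Qed.

Lemma free_act_linearr p : linear (free_act p).
Proof.
move=> a m n; rewrite /free_act scaler_sumr -big_split /=.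
apply: eq_bigr => w _; rewrite word_act_linear scalerDr !scalerA.
by rewrite mulrC.
Qed.

Lemma free_act0l m : free_act 0 m = 0.
Proof. by rewrite /free_act msupp0 big_seq_fset0. Qed.

Lemma free_act0r p : free_act p 0 = 0.
Proof. by have := free_act_linearr p (-1) 0 0; rewrite scaler0 addr0 scaleN1r addNr. Qed.

Lemma free_actD p q m : free_act (p + q) m = free_act p m + free_act q m.
Proof. by have := free_act_linearl m 1 p q; rewrite !scale1r. Qed.

Lemma free_actDr p m n : free_act p (m + n) = free_act p m + free_act p n.
Proof. by have := free_act_linearr p 1 m n; rewrite !scale1r. Qed.

Lemma free_actZr p a m : free_act p (a *: m) = a *: free_act p m.
Proof. by have := free_act_linearr p a m 0; rewrite free_act0r !addr0. Qed.

Lemma free_actB p q m : free_act (p - q) m = free_act p m - free_act q m.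
Proof.
have := free_act_linearl m (-1) q p.
by rewrite !scaleN1r [- q + p]addrC [_ + free_act p m]addrC.
Qed.

Lemma free_actM p q m : free_act (p * q) m = free_act p (free_act q m).
Proof.
have suml I r (F : I -> free_alg) n :
    free_act (\sum_(i <- r) F i) n = \sum_(i <- r) free_act (F i) n.
  exact: (big_morph _ (fun x y => free_actD x y n) (free_act0l n)).
rewrite malgME exchange_big /= suml [free_act q m]/free_act.
rewrite (big_morph _ (free_actDr p) (free_act0r p)).
apply: eq_bigr => w' _; rewrite suml free_actZr /free_act scaler_sumr.
apply: eq_bigr => w _; rewrite -/(free_act _ _) free_actU scalerA mulrC.
by congr (_ *: _); rewrite /word_act fmM foldr_cat.
Qed.

Lemma free_act1 m : free_act 1 m = m.
Proof. by rewrite free_actU scale1r /word_act fm1. Qed.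

Lemma free_act_fgen x m : free_act (fgen x) m = lact x m.
Proof. by rewrite free_actU scale1r /word_act fmU. Qed.

Lemma uenv_rel_act p : uenv_rel p -> forall m, free_act p m = 0.
Proof.
elim=> [a x y|x y|q r _ hq _ hr|q r _ hr|q r _ hq] m.
- rewrite free_actB (free_act_linearl m a) !free_act_fgen lact_linearl.
  by rewrite subrr.
- by rewrite !free_actB !free_actM !free_act_fgen lact_bracket subrr.
- by rewrite free_actB hq hr subr0.
- by rewrite free_actM hr free_act0r.
- by rewrite free_actM hq.
Qed.

Lemma uactE p m : uact (upi p) m = free_act p m.
Proof.
by apply/eqP; rewrite -subr_eq0 -free_actB; apply/eqP/uenv_rel_act/upi_reprB.
Qed.

Fact uact_iota x m : uact (uiota x) m = lact x m.
Proof. by rewrite uactE free_act_fgen. Qed.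

Fact uactA u v m : uact u (uact v m) = uact (u * v) m.
Proof. by rewrite -[u]ureprK -[v]ureprK -[_ * _]upiM !uactE free_actM. Qed.

Fact uact1 : left_id 1 uact.
Proof. by move=> m; rewrite uactE free_act1. Qed.

Fact uactDr : right_distributive uact +%R.
Proof. by move=> u m n; apply: free_actDr. Qed.

Fact uactDl m : {morph uact^~ m : u v / u + v}.
Proof.
by move=> u v; rewrite -[u]ureprK -[v]ureprK -upiD !uactE free_actD.
Qed.

(* M viewed as a module over U(L). *)
Definition uenvMod : Type := M.

HB.instance Definition _ := GRing.Zmodule.copy uenvMod M.
HB.instance Definition _ := GRing.Zmodule_isLmodule.Build (uenv L) uenvMod
  uactA uact1 uactDr uactDl.

End EnvelopingModule.

(** * Properties of modules over a ring *)

Definition finitely_generated (A : nzRingType) (V : lmodType A) :=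
  exists s : seq V, forall v, exists c : nat -> A,
    v = \sum_(i < size s) c i *: s`_i.

(* The usual notion when A is a domain, such as an enveloping algebra: every
   nonzero scalar then counts as regular. *)
Definition torsion_free (A : nzRingType) (V : lmodType A) :=
  forall (a : A) (v : V), a *: v = 0 -> a = 0 \/ v = 0.

(* Main.v *)
(* Write [g = h + sum of root spaces]; over a simple [g] the subalgebra [h] is
   abelian and acts diagonalisably, so [U(h)] is a quotient of a polynomial ring
   and a root vector [e] of weight [alpha] satisfies [e p = p(. - alpha) e] on [M]
   for a polynomial [p]. Hence the torsion elements of [M] form a g-submodule; if
   there is a nonzero one, then [M] is torsion and, being finitely generated, it
   is killed by some nonzero [p], which we take of least degree. Since the roots
   span the dual of [h] and [p] is not constant, some root [alpha] moves [p]. The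
   last nonzero iterated difference [q] of [p] along [alpha] has smaller degree,
   commutes with [e] and satisfies [q e^n M = 0] while [q M] is nonzero; thus [e]
   is nilpotent on a nonzero vector, hence locally nilpotent on [M], hence
   nilpotent on [M]. The elements of [g] acting nilpotently on [M] are stable
   under [exp (t ad y)] for every ad-nilpotent [y], so their span is an ideal,
   i.e. all of [g]. Finally, if [g] is spanned by [x_1 .. x_n] with
   [x_i^K M = 0], any word of length [> n K] in the [x_i] can be rewritten on [M]
   through shorter words, so [M] is finite-dimensional. *)

Require Import Defs.
From HB Require Import structures.
From mathcomp Require Import all_boot all_order all_algebra.
From mathcomp Require Import complex reals.
From mathcomp Require Import boolp ring mpoly.
From mathcomp Require finmap monalg.

Set Implicit Arguments.
Unset Strict Implicit.
Unset Printing Implicit Defensive.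

Import Order.TTheory GRing.Theory Num.Theory.
Local Open Scope ring_scope.

(** * Commutators and commuting idempotents *)

(** That [h] is abelian and acts diagonalisably is about half of the work, because a Cartan
    subalgebra is given only as nilpotent and self-normalising: at the start its elements neither
    commute nor are semisimple. Weight spaces are therefore encoded by idempotent matrices commuting
    with [ad h], and a weight is a normalised trace against such an idempotent. This makes weights
    linear at once and multiplicities positive reals. The pivot is that the Killing form is nonzero.
    If it vanished, the bracket of two opposite weight vectors, whose weights are real multiples of
    a single number, would have all weights 0 by positivity of real squares; since g is perfect,
    only the weight 0 would survive and g would equal the nilpotent [h]. Nondegeneracy then removes
    both [h, h] and the nilpotent parts of [ad h]. *)

Section RingCommutators.
Variable R : nzRingType.
Implicit Types X Y Z P Q : R.

Definition commr X Y := X * Y - Y * X.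

Lemma commr_eq0 X Y : commr X Y = 0 <-> X * Y = Y * X.
Proof. by split=> [/subr0_eq //|]; rewrite /commr => ->; rewrite subrr. Qed.

Lemma commr_swap X P Z : X * P = P * X ->
  commr X (commr P Z) = commr P (commr X Z).
Proof.
move=> XP; have ZXP : Z * P * X = Z * X * P by rewrite -!mulrA XP.
rewrite /commr !(mulrBr, mulrBl) !mulrA ZXP XP !opprB.
by rewrite addrACA [RHS]addrACA; congr (_ + _); rewrite addrC.
Qed.

Lemma iter_commr_swap m X P Z : X * P = P * X ->
  iter m (commr X) (commr P Z) = commr P (iter m (commr X) Z).
Proof. by move=> XP; elim: m => //= m ->; rewrite commr_swap. Qed.

(* If P lies in the bicommutant of X, an ad-nilpotent Y can be moved across a
   power of P; hence generalised eigenspaces of X are Y-stable. *)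
Lemma commr_nilp_pow m X P Y :
    (forall Z, X * Z = Z * X -> P * Z = Z * P) ->
    iter m (commr X) Y = 0 ->
  exists Z, P ^+ m * Y = Z * P.
Proof.
move=> bicomm; have XP : X * P = P * X by rewrite (bicomm X).
elim: m Y => [|m IH] Y /=; first by move=> ->; exists 0; rewrite mulr0 mul0r.
move=> hY; have [|Z hZ] := IH (commr P Y).
  by rewrite iter_commr_swap //; apply/commr_eq0/bicomm/commr_eq0.
exists (P ^+ m * Y + Z); rewrite mulrDl -hZ /commr mulrBr !mulrA exprSr.
by rewrite addrC addrNK.
Qed.

(** On the image of [G] the element [P] is invertible with inverse [V], while [P] kills [H].
    Inserting powers of [V P] next to [G] and moving [Y] across a power of [P] brings a factor [P]
    against [H]. *)
Lemma commr_nilp_pow0 m X P V Y G H :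
    (forall Z, X * Z = Z * X -> P * Z = Z * P) ->
    iter m (commr X) Y = 0 -> V * P = P * V ->
    G = V * P * G -> G * P = P * G -> G * V = V * G ->
    P * H = 0 -> G * Y * H = 0.
Proof.
move=> bicomm hY VP GE GP GV PH.
have Gk : G = (V * P) ^+ m.+1 * G.
  by elim: m.+1 => [|k IH]; rewrite ?expr0 ?mul1r // exprSr -mulrA -GE.
have GVP : GRing.comm G (V * P) by rewrite /GRing.comm mulrA GV -mulrA GP mulrA.
rewrite Gk -(commrX _ GVP) exprMn_comm // [P ^+ _]exprS.
have [Z hZ] := commr_nilp_pow bicomm hY.
rewrite -!mulrA [P ^+ m * _]mulrA hZ.
by rewrite -[Z * P * H]mulrA PH !mulr0.
Qed.
End RingCommutators.

(** * Traces of nilpotent and idempotent matrices *)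

Section MatrixTrace.
Variables (F : numClosedFieldType) (n : nat).
Implicit Types X Y E : 'M[F]_n.+1.

(** All eigenvalues are 0, so the characteristic polynomial is a pure power of the variable, and its
    subleading coefficient is minus the trace. *)
Lemma mxtrace_nilp X k : X ^+ k = 0 -> \tr X = 0.
Proof.
move=> Xk; have [r pE] := closed_field_poly_normal (char_poly X).
move: pE; rewrite (monicP (char_poly_monic X)) scale1r => pE.
have r0 a : a \in r -> a = 0.
  move=> ar; have : root (char_poly X) a by rewrite pE root_prod_XsubC.
  rewrite -eigenvalue_root_char => /eigenvalueP[v vX v0].
  have : v *m X ^+ k = a ^+ k *: v.
    elim: k {Xk} => [|k IH]; first by rewrite !expr0 scale1r mulmx1.
    by rewrite exprSr mulmxA IH -scalemxAl vX scalerA -exprSr.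
  rewrite Xk mulmx0 => /esym/eqP; rewrite scaler_eq0 (negPf v0) orbF.
  by rewrite expf_eq0 => /andP[_ /eqP].
have pX : char_poly X = 'X^(n.+1).
  have := size_char_poly X; rewrite pE size_prod_XsubC => -[<-].
  rewrite (eq_big_seq (fun=> 'X)) ?big_const_seq ?count_predT ?iter_mulr_1 //.
  by move=> a /r0 ->; rewrite subr0.
have := char_poly_trace X isT; rewrite pX coefXn /= ltn_eqF // => /eqP.
by rewrite eq_sym oppr_eq0 => /eqP.
Qed.

(** In the rank factorisation of [E] as C B, idempotence forces B C to be the identity of size the
    rank; the trace is cyclic. *)
Lemma mxtrace_idem E : E * E = E -> \tr E = (\rank E)%:R.
Proof.
move=> EE; have CB := mulmx_base E.
have BC : row_base E *m col_base E = 1%:M.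
  apply: (row_full_inj (col_base_full E)); apply: (row_free_inj (row_base_free E)).
  by rewrite mulmx1 CB mulmxA CB -mulmxA CB; exact: EE.
by rewrite -{1}CB mxtrace_mulC BC mxtrace1.
Qed.
End MatrixTrace.

(** * Joint generalised eigenspaces as commuting idempotents *)

Section PrimaryIdempotents.
Variables (F : numClosedFieldType) (n : nat).
Local Notation Mn := 'M[F]_n.+1.
Variable S : Mn -> Prop.
Hypothesis S_nilp : forall X Y, S X -> S Y -> exists m, iter m (commr X) Y = 0.
Implicit Types X Y E G : Mn.

Definition commutesS E := forall X, S X -> X * E = E * X.

(* Split a polynomial f of least degree with f(X) E = 0 as (X - c)^m q with
   q(c) <> 0; the Bezout idempotents are then stable under S. *)
Lemma primary_piece E X : S X -> E * E = E -> E != 0 -> commutesS E ->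
  exists c k G, [/\ (X - c%:M) ^+ k * G = 0, G * G = G, G != 0, commutesS G &
    G * E = G /\ E * G = G].
Proof.
move=> SX EE E0 cE; have XE := cE X SX.
pose ann (f : {poly F}) := f != 0 /\ horner_mx X f * E = 0.
have [k0 hk0] : exists k, `[< exists2 f, ann f & size f = k >].
  exists (size (char_poly X)); apply/asboolP; exists (char_poly X) => //; split.
    exact/monic_neq0/char_poly_monic.
  by rewrite Cayley_Hamilton mul0r.
pose has_size k := `[< exists2 f, ann f & size f = k >].
have [_ /asboolP[f [f0 fE] <-] fmin] := find_ex_minn (ex_intro has_size k0 hk0).
have [c fc] : exists c, root f c.
  apply: (closed_rootP f); apply/negP => /eqP f1.
  have := @size1_polyC _ f; rewrite f1 => /(_ isT) fC.
  move: fE f0; rewrite fC horner_mx_C polyC_eq0 => /(congr1 (fun Z => (f`_0)^-1 *: Z)).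
  rewrite scaler0 -mulmxE mul_scalar_mx scalerA => + c0; rewrite mulVf // scale1r.
  by move/eqP; rewrite (negPf E0).
have [m [q qc fq]] := multiplicity_XsubC f c.
rewrite f0 /= in qc.
have m0 : (0 < m)%N.
  by case: m fq => // fq; move: qc; rewrite -(mulr1 q) -(expr0 ('X - c%:P)) -fq fc.
have cop : coprimep (('X - c%:P) ^+ m) q by rewrite coprimep_expl // coprimep_sym coprimep_XsubC.
have [[u v] /= uv] := Bezout_eq1_coprimepP _ _ cop.
set p := ('X - c%:P) ^+ m in cop uv fq *.
have hE r : E * horner_mx X r = horner_mx X r * E.
  exact/comm_mx_horner/esym.
pose hx r := horner_mx X r * E.
have hxD r s : hx (r + s) = hx r + hx s by rewrite /hx rmorphD mulrDl.
have hxM r s : hx r * hx s = hx (r * s).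
  by rewrite /hx rmorphM /= -!mulrA (mulrA E) hE -mulrA EE mulrA.
have hxMl r s : horner_mx X r * hx s = hx (r * s) by rewrite /hx rmorphM mulrA.
have hxMr r s : hx s * horner_mx X r = hx (r * s).
  by rewrite /hx -mulrA hE mulrA mulrC rmorphM.
have hx1 : hx 1 = E by rewrite /hx rmorph1 mul1r.
have hx0 r : hx (r * f) = 0 by rewrite -hxMl [hx f]fE mulr0.
have vq2 : hx (v * q * (v * q)) = hx (v * q).
  have -> : v * q * (v * q) = v * q * (u * p + v * q) - v * u * f by rewrite fq; ring.
  by rewrite uv mulr1 -scaleN1r -mul_polyC hxD mulrA hx0 addr0.
have up2 : hx (u * p * (u * p)) = hx (u * p).
  have -> : u * p * (u * p) = u * p * (u * p + v * q) - v * u * f by rewrite fq; ring.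
  by rewrite uv mulr1 -scaleN1r -mul_polyC hxD mulrA hx0 addr0.
have bic r Z : X * Z = Z * X -> horner_mx X r * Z = Z * horner_mx X r.
  by move=> XZ; apply: comm_horner_mx.
(* Used for both off-diagonal blocks of [Y]: on the left idempotent [b] has inverse [a], on the
   right one [b] acts as 0. *)
have vanish a b a' b' Y : S Y -> hx (a * b * (a * b)) = hx (a * b) ->
    hx (b * (a' * b')) = 0 -> hx (a * b) * Y * hx (a' * b') = 0.
  move=> SY ab2 b0; have [j hj] := S_nilp SX SY.
  apply: (commr_nilp_pow0 (P := horner_mx X b) (V := horner_mx X a) (bic b) hj).
  - exact: comm_horner_mx2.
  - by rewrite -rmorphM hxMl.
  - by rewrite hxMl hxMr.
  - by rewrite hxMl hxMr.
  - by rewrite hxMl.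
have sumE : hx (v * q) + hx (u * p) = E by rewrite -hxD addrC uv.
have EhxE r : E * hx r = hx r by rewrite /hx mulrA hE -mulrA EE.
have hxEE r : hx r * E = hx r by rewrite /hx -mulrA EE.
exists c, m, (hx (v * q)); split.
- have -> : (X - c%:M) ^+ m = horner_mx X p.
    by rewrite rmorphXn /= rmorphB /= horner_mx_X horner_mx_C.
  by rewrite hxMl (_ : p * (v * q) = v * f) ?hx0 // fq; ring.
- by rewrite hxM vq2.
(* Were this idempotent 0, [q] alone would annihilate [E], against the minimality of [f], whose
   degree is larger by the positive [m]. *)
- apply/negP => /eqP vq0; move: sumE; rewrite vq0 add0r => upE.
  have qE : ann q.
    split; first by apply: contraNneq f0 => q0; rewrite fq q0 mul0r.
    rewrite -[LHS]/(hx q) -hxEE -upE hxM (_ : q * _ = u * f) ?hx0 // fq; ring.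
  have /asboolP/fmin : exists2 f, ann f & size f = size q by exists q.
  rewrite leqNgt fq size_Mmonic ?monic_exp ?monicXsubC //; last first.
    by case: qE.
  rewrite size_exp_XsubC addnS /=.
  by rewrite -[X in (X < _)%N]addn0 ltn_add2l m0.
- move=> Y SY.
  have YE := cE Y SY.
  have h1 : hx (v * q) * Y * hx (u * p) = 0.
    apply: vanish => //; rewrite (_ : _ * _ = u * f) ?hx0 // fq; ring.
  have h2 : hx (u * p) * Y * hx (v * q) = 0.
    apply: vanish => //; rewrite (_ : _ * _ = v * f) ?hx0 // fq; ring.
  have -> : Y * hx (v * q) = hx (v * q) * Y * hx (v * q).
    by rewrite -{1}[hx _]EhxE mulrA YE -sumE !mulrDl h2 addr0.
  rewrite -[in RHS](hxEE (v * q)) -[RHS]mulrA -YE mulrA -[E in RHS]sumE mulrDr.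
  by rewrite h1 addr0.
- by split.
Qed.

Definition primary E :=
  [/\ E * E = E, E != 0, commutesS E &
    forall X, S X -> exists c k, (X - c%:M) ^+ k * E = 0].

(** Induction on the rank: an [E] that is not primary splits into two nonzero idempotents, whose
    ranks add up because their traces do. *)
Lemma primary_decomposition_under r E : (\rank E < r)%N ->
    E * E = E -> commutesS E ->
  exists s : seq Mn, [/\ forall G, G \in s -> primary G,
    pairwise (fun G G' => (G * G' == 0) && (G' * G == 0)) s & \sum_(G <- s) G = E].
Proof.
elim: r E => // r IH E rE EE cE.
have [->|E0] := eqVneq E 0; first by exists [::]; rewrite big_nil; split.
have [pE|] := pselect (forall X, S X -> exists c k, (X - c%:M) ^+ k * E = 0).
  exists [:: E]; rewrite big_seq1; split=> // G; rewrite inE => /eqP ->.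
  by split.
move=> /existsNP[X /not_implyP[SX nX]].
have [c [k [G [XG GG G0 cG [GE EG]]]]] := primary_piece SX EE E0 cE.
pose H := E - G.
have HH : H * H = H by rewrite /H mulrBr !mulrBl EE GE EG GG subrr subr0.
have H0 : H != 0.
  apply/negP; rewrite subr_eq0 => /eqP EG'; apply: nX; exists c, k.
  by rewrite EG'.
have cH : commutesS H by move=> Y SY; rewrite mulrBr mulrBl cE // cG.
have GH : G * H = 0 by rewrite mulrBr GE GG subrr.
have HG : H * G = 0 by rewrite mulrBl EG GG subrr.
have rk : (\rank G + \rank H = \rank E)%N.
  apply/eqP; rewrite -(eqr_nat F) natrD -!mxtrace_idem //.
  by rewrite -mxtraceD addrC subrK.
have rk0 Z : Z != 0 :> Mn -> (0 < \rank Z)%N by rewrite lt0n mxrank_eq0.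
have [|s [sP sO sG]] := IH G _ GG cG.
  apply: leq_trans (rE : (\rank E <= r)%N).
  by rewrite -rk -[X in (X < _)%N]addn0 ltn_add2l rk0.
have [|t [tP tO tH]] := IH H _ HH cH.
  apply: leq_trans (rE : (\rank E <= r)%N).
  by rewrite -rk -[X in (X < _)%N]add0n ltn_add2r rk0.
(* A summand [Z] of a decomposition of [W] is fixed by [W] on both sides, so the orthogonality of
   [G] and [H] passes to their summands. *)
have absorb (w : seq Mn) Z W : (forall G, G \in w -> primary G) ->
    pairwise (fun G G' => (G * G' == 0) && (G' * G == 0)) w ->
    \sum_(G <- w) G = W -> Z \in w -> Z * W = Z /\ W * Z = Z.
  elim: w W => // Z0 w IHw W wP /= /andP[/allP Z0w wO]; rewrite big_cons => <-.
  have [idZ0 _ _ _] := wP Z0 (mem_head _ _).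
  rewrite inE => /orP[/eqP ->|Zw].
    rewrite mulrDr mulrDl mulr_sumr mulr_suml idZ0 !big1_seq ?addr0 //.
      by move=> i /= /Z0w /andP[_ /eqP].
    by move=> i /= /Z0w /andP[/eqP].
  have [] := IHw _ (fun G Gw => wP G (mem_behead (Gw : G \in behead (Z0 :: w)))) wO erefl Zw.
  by rewrite mulrDr mulrDl => -> ->; have /andP[/eqP-> /eqP->] := Z0w Z Zw; rewrite !add0r.
exists (s ++ t); split.
- by move=> Z; rewrite mem_cat => /orP[/sP|/tP].
- rewrite pairwise_cat sO tO !andbT; apply/allrelP => Y Z Ys Zt.
  have [YG GY] := absorb s Y G sP sO sG Ys; have [ZH HZ] := absorb t Z H tP tO tH Zt.
  rewrite -{1}YG -{1}HZ mulrA -[Y * G * H]mulrA GH mulr0 mul0r eqxx /=.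
  by rewrite -ZH -GY mulrA -[Z * H * G]mulrA HG mulr0 mul0r.
- by rewrite big_cat /= sG tH addrC subrK.
Qed.

Lemma primary_decomposition :
  exists s : seq Mn, [/\ uniq s, forall G, G \in s -> primary G,
    {in s &, forall G H, G != H -> G * H = 0} & \sum_(G <- s) G = 1].
Proof.
have [|||s [sP sO s1]] := @primary_decomposition_under n.+2 1.
- by rewrite ltnS rank_leq_row.
- by rewrite mulr1.
- by move=> X _; rewrite mulr1 mul1r.
exists s; split=> //.
  elim: s sP sO {s1} => //= G s IH sP /andP[/allP GO sO]; rewrite IH // ?andbT.
    apply/negP => /GO /andP[]; have [-> G0 _ _] := sP G (mem_head _ _).
    by rewrite (negPf G0).
  by move=> H Hs; apply: sP; rewrite inE Hs orbT.
elim: s sP sO {s1} => //= G s IH sP /andP[/allP GO sO] A B.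
rewrite !inE => /orP[/eqP->|As] /orP[/eqP->|Bs]; rewrite ?eqxx //.
- by case/andP: (GO _ Bs) => /eqP.
- by case/andP: (GO _ As) => _ /eqP.
- by apply: IH => // H Hs; apply: sP; rewrite inE Hs orbT.
Qed.
End PrimaryIdempotents.

(** * Lie algebras, ideals and the Killing form *)

Section BracketTheory.
Variables (K : fieldType) (L : lieAlgType K).
Implicit Types x y z : L.

HB.instance Definition _ x :=
  GRing.isLinear.Build K L L *:%R (bracket x) (bracket_linearr x).

Lemma bracketC x y : bracket x y = - bracket y x.
Proof.
have := bracketxx (x + y); have DE a := bracket_linearl a 1 x y.
rewrite -[x in x + y](scale1r x) DE !scale1r !linearD /= !bracketxx.
by rewrite add0r addr0 => /eqP; rewrite addr_eq0 => /eqP.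
Qed.

Lemma bracketDl z : {morph bracket^~ z : x y / x + y}.
Proof. by move=> x y; rewrite /= bracketC linearD opprD /= -!(bracketC _ z). Qed.

Lemma bracketZl a x y : bracket (a *: x) y = a *: bracket x y.
Proof. by rewrite bracketC linearZ /= -scalerN -bracketC. Qed.

Lemma bracket0l x : bracket 0 x = 0.
Proof. by rewrite bracketC linear0 oppr0. Qed.

Lemma bracket_suml I (r : seq I) P (f : I -> L) y :
  bracket (\sum_(i <- r | P i) f i) y = \sum_(i <- r | P i) bracket (f i) y.
Proof. exact: (big_morph _ (bracketDl y) (bracket0l y)). Qed.

Lemma bracket_derivation x y z :
  bracket x (bracket y z) = bracket (bracket x y) z + bracket y (bracket x z).
Proof.
apply/eqP; rewrite -subr_eq0 -(bracket_jacobi x y z) opprD addrAC -addrA.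
apply/eqP; congr (_ + _); rewrite addrC -bracketC [in RHS]addrC.
by rewrite [bracket z x]bracketC linearN /=.
Qed.

Lemma iter_bracket0 m x : iter m (bracket x) 0 = 0.
Proof. by elim: m => //= m ->; rewrite linear0. Qed.
End BracketTheory.

(** A subspace inside [Q] is enlarged vector by vector until the dimension stops it. Ideals and
    stabilisers may then be given as plain predicates. *)
Lemma vspace_of_pred (K : fieldType) (V : vectType K) (Q : V -> Prop) :
    Q 0 -> (forall a u v, Q u -> Q v -> Q (a *: u + v)) ->
  exists U : {vspace V}, forall x, x \in U <-> Q x.
Proof.
move=> Q0 Qlin.
suff ext k (U : {vspace V}) : (\dim {:V} - \dim U < k)%N ->
    (forall x, x \in U -> Q x) -> exists U : {vspace V}, forall x, x \in U <-> Q x.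
  by apply: (ext _ 0%VS (ltnSn _)) => x; rewrite memv0 => /eqP ->.
elim: k U => // k IH U; rewrite ltnS => Uk UQ.
have [[x Qx xU]|nex] := pselect (exists2 x, Q x & x \notin U); last first.
  exists U => x; split=> [/UQ //|Qx].
  by apply/negPn/negP => xU; apply: nex; exists x.
apply: (IH (<[x]> + U)%VS).
  have dimU : (\dim U < \dim (<[x]> + U))%N.
    rewrite ltn_neqAle dimvS ?addvSr // andbT; apply: contra xU => eqd.
    have /eqP-> : U == (<[x]> + U)%VS by rewrite eqEdim addvSr (eqP eqd) leqnn.
    by apply: (subvP (addvSl _ _)); rewrite memv_line.
  apply: leq_trans Uk; rewrite ltn_sub2l //.
  by apply: leq_trans dimU (dimvS (subvf _)).
move=> y /memv_addP[_ /vlineP[a ->] [v /UQ Qv ->]].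
exact: Qlin.
Qed.

Section IdealsAndSeries.
Variables (K : fieldType) (g : finLieAlgType K).
Implicit Types (x y z : g) (U V : {vspace g}).

Lemma memv_bracketv U V x y : x \in U -> y \in V -> bracket x y \in bracketv U V.
Proof.
move=> xU yV; rewrite (coord_vbasis xU) (coord_vbasis yV) bracket_suml.
apply: rpred_sum => i _; rewrite linear_sum; apply: rpred_sum => j _ /=.
rewrite linearZ /= bracketZl !rpredZ //; apply: memv_span.
by apply: allpairs_f; rewrite mem_nth ?size_tuple.
Qed.

Lemma bracketv_ind U V (Q : g -> Prop) :
    Q 0 -> (forall a u v, Q u -> Q v -> Q (a *: u + v)) ->
    (forall x y, x \in U -> y \in V -> Q (bracket x y)) ->
  forall z, z \in bracketv U V -> Q z.
Proof.
move=> Q0 Qlin Qb z; have [W WQ] := vspace_of_pred Q0 Qlin.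
suff /subvP sub : (bracketv U V <= W)%VS by move=> /sub/WQ.
apply/span_subvP => _ /allpairsP[[x y] /= [xU yV ->]]; apply/WQ/Qb.
  exact: vbasis_mem xU.
exact: vbasis_mem yV.
Qed.

Lemma simple_ideal_trichotomy (Q : g -> Prop) : simple_lie g ->
    Q 0 -> (forall a u v, Q u -> Q v -> Q (a *: u + v)) ->
    (forall x y, Q y -> Q (bracket x y)) ->
  (forall x, Q x -> x = 0) \/ (forall x, Q x).
Proof.
move=> [_ sg] Q0 Qlin Qid; have [W WQ] := vspace_of_pred Q0 Qlin.
have [|W0|W1] := sg W.
- by move=> x y /WQ/(Qid x)/WQ.
- by left=> x /WQ; rewrite W0 memv0 => /eqP.
- by right=> x; apply/WQ; rewrite W1 memvf.
Qed.

Lemma simple_perfect : simple_lie g -> bracketv (fullv : {vspace g}) fullv = fullv.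
Proof.
move=> sg; have [[x [y xy]] si] := sg.
have [|I0|->//] := si (bracketv fullv fullv).
  by move=> a b _; rewrite memv_bracketv ?memvf.
by have := memv_bracketv (memvf x) (memvf y); rewrite I0 memv0 (negPf xy).
Qed.

Lemma simple_centerless x : simple_lie g -> (forall y, bracket x y = 0) -> x = 0.
Proof.
move=> sg; have [[a [b ab]] _] := sg.
have [|||Q0|Q1] := simple_ideal_trichotomy (Q := fun x => forall y, bracket x y = 0) sg.
- exact: bracket0l.
- by move=> c u v hu hv y; rewrite bracketDl bracketZl hu hv scaler0 addr0.
- by move=> u v hv y; rewrite [bracket u v]bracketC hv oppr0 bracket0l.
- exact: Q0.
- by rewrite Q1 eqxx in ab.
Qed.

Variable h : lieSubalg g.

Lemma lower_central_ideal k x y : x \in (h : {vspace g}) ->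
  y \in lower_central h k -> bracket x y \in lower_central h k.
Proof.
move=> xh; elim: k y => [|k IH] y; first exact: lieSubalg_bracket.
apply: (bracketv_ind (Q := fun z => bracket x z \in lower_central h k.+1)) => [|a u v hu hv|u v hu hv].
- by rewrite linear0 mem0v.
- by rewrite linearD linearZ /= rpredD ?rpredZ.
- rewrite bracket_derivation rpredD // memv_bracketv //.
    exact: lieSubalg_bracket.
  exact: IH.
Qed.

Lemma lower_central_sub k y : y \in lower_central h k -> y \in (h : {vspace g}).
Proof.
elim: k y => // k IH y.
apply: (bracketv_ind (Q := fun z => z \in (h : {vspace g}))) => [|a u v hu hv|u v hu hv].
- exact: mem0v.
- by rewrite rpredD ?rpredZ.
- exact/lieSubalg_bracket/IH.
Qed.
End IdealsAndSeries.

Lemma eigen_pow_disjoint (F : fieldType) (n m : nat) (X : 'M[F]_n.+1)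
    (W : 'M[F]_(n.+1, m)) (a b : F) (j k : nat) : a != b ->
  (X - a%:M) ^+ j *m W = 0 -> (X - b%:M) ^+ k *m W = 0 -> W = 0.
Proof.
move=> ab Wj Wk.
have cop : coprimep (('X - a%:P) ^+ j) (('X - b%:P) ^+ k).
  by rewrite coprimep_expl // coprimep_expr // coprimep_XsubC2 // subr_eq0 eq_sym.
have [[u v] /= uv] := Bezout_eq1_coprimepP _ _ cop.
have hX c : X - c%:M = horner_mx X ('X - c%:P).
  by rewrite rmorphB /= horner_mx_X horner_mx_C.
move: Wj Wk; rewrite !hX -!rmorphXn /= => Wj Wk.
have := congr1 (fun Z => Z *m W) (congr1 (horner_mx X) uv).
rewrite rmorphD !rmorphM rmorph1 /= mul1mx => <-.
by rewrite mulmxDl -!mulmxA Wj Wk !mulmx0 addr0.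
Qed.

(* Leibniz: (ad X - a) and (X - b) add up to (X - a - b) acting on products. *)
Lemma leibniz_nilp (F : fieldType) (n : nat) (X : 'M[F]_n.+1) (a b : F) i j
    (Y E : 'M[F]_n.+1) :
  iter i (fun Z => commr X Z - a *: Z) Y = 0 -> (X - b%:M) ^+ j * E = 0 ->
  (X - (a + b)%:M) ^+ (i + j) * (Y * E) = 0.
Proof.
move eqk: (i + j)%N => k; elim: k i j Y E eqk => [|k IH] [|i] [|j] Y E //.
- by move=> _ /= ->; rewrite mul0r mulr0.
- by move=> _ /= ->; rewrite mul0r mulr0.
- by move=> _ _; rewrite expr0 mul1r => ->; rewrite !mulr0.
rewrite addSn => -[eqk] hY hE.
have -> : (X - (a + b)%:M) ^+ k.+1 * (Y * E) =
    (X - (a + b)%:M) ^+ k * ((commr X Y - a *: Y) * E)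
    + (X - (a + b)%:M) ^+ k * (Y * ((X - b%:M) * E)).
  rewrite -mulrDr exprSr -mulrA; congr (_ * _).
  have sc e (Z : 'M[F]_n.+1) : e%:M * Z = e *: Z by exact: mul_scalar_mx.
  rewrite /commr !mulrBl mulrBr !sc -scalerAl -scalerAr !mulrA scalerDl opprD.
  by rewrite [RHS]addrA [in RHS](addrAC _ _ (Y * X * E)) subrK addrA.
rewrite (IH i j.+1 _ _ eqk _ hE) ?add0r; last by move: hY; rewrite iterSr.
by rewrite (IH i.+1 j _ _ _ hY) // ?addSnnS // mulrA -exprSr.
Qed.

(** * The adjoint representation in matrices and the Killing form *)

Section AdjointMatrices.
Variables (F : numClosedFieldType) (g : finLieAlgType F) (n : nat).
Variables (c : {linear g -> 'cV[F]_n.+1}) (d : 'cV[F]_n.+1 -> g).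
Hypotheses (cK : cancel c d) (dK : cancel d c).
Implicit Types (x y z u v : g) (M N : 'M[F]_n.+1).

Definition admx x : 'M[F]_n.+1 :=
  \matrix_(i, j) c (bracket x (d (delta_mx j 0))) i 0.

Lemma coord_inv_linear : linear d.
Proof. by move=> a u v; apply: (can_inj cK); rewrite linearP !dK. Qed.

HB.instance Definition _ := GRing.isLinear.Build F 'cV[F]_n.+1 g *:%R d coord_inv_linear.

Lemma admxE x y : admx x *m c y = c (bracket x y).
Proof.
have -> : bracket x y = \sum_j c y j 0 *: bracket x (d (delta_mx j 0)).
  rewrite -[in LHS](cK y) [c y in LHS]matrix_sum_delta !linear_sum /=.
  by apply: eq_bigr => j _; rewrite big_ord1 !linearZ.
rewrite linear_sum; apply/colP => i; rewrite !mxE summxE; apply: eq_bigr => j _.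
by rewrite linearZ !mxE mulrC.
Qed.

Lemma mx_coordP M N : (forall y, M *m c y = N *m c y) -> M = N.
Proof.
move=> MN; apply/matrixP => i j; have := MN (d (delta_mx j 0)).
by rewrite dK -!colE => /colP/(_ i); rewrite !mxE.
Qed.

Lemma admx_linear : linear admx.
Proof.
move=> a x y; apply: mx_coordP => z.
by rewrite mulmxDl -scalemxAl !admxE bracketDl bracketZl linearD linearZ.
Qed.

HB.instance Definition _ := GRing.isLinear.Build F g 'M[F]_n.+1 *:%R admx admx_linear.

Lemma admx_bracket x y : admx (bracket x y) = commr (admx x) (admx y).
Proof.
apply: mx_coordP => z; rewrite /commr mulmxBl -!mulmxE -!mulmxA !admxE.
by rewrite -linearB bracket_derivation addrK.
Qed.

Definition killing x y := \tr (admx x * admx y).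

Lemma killingDl x y z : killing (x + y) z = killing x z + killing y z.
Proof. by rewrite /killing linearD mulrDl mxtraceD. Qed.

Lemma killingC x y : killing x y = killing y x.
Proof. exact: mxtrace_mulC. Qed.

Lemma killing_bracket x y z : killing (bracket x y) z = killing x (bracket y z).
Proof.
rewrite /killing !admx_bracket /commr mulrBl mulrBr !raddfB /= !mulrA.
rewrite -[admx y * admx x * admx z]mulrA; congr (_ - _).
exact: mxtrace_mulC.
Qed.

(** By invariance the radical of the form is an ideal; it is proper as soon as one value is
    nonzero. *)
Lemma killing_nondeg : simple_lie g -> (exists x y, killing x y != 0) ->
  forall x, (forall y, killing x y = 0) -> x = 0.
Proof.
move=> sg [a [b ab]] x.
have [|||Q0|Q1] := simple_ideal_trichotomy
    (Q := fun x => forall y, killing x y = 0) sg.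
- by move=> y; rewrite /killing linear0 mul0r mxtrace0.
- move=> e u v hu hv y.
  by rewrite /killing linearP mulrDl mxtraceD -scalerAl mxtraceZ -/(killing u y)
    -/(killing v y) hu hv mulr0 addr0.
- by move=> u v hv y; rewrite bracketC -linearN killing_bracket hv.
- exact: Q0.
- by rewrite Q1 eqxx in ab.
Qed.

End AdjointMatrices.

Section Coordinates.
Import VectorInternalTheory.

(** The dimension is a successor because some bracket is nonzero; this gives square matrices their
    ring structure. *)
Lemma coordinates (F : fieldType) (g : finLieAlgType F) : simple_lie g ->
  exists n (c : {linear g -> 'cV[F]_n.+1}) d, cancel c d /\ cancel d c.
Proof.
move=> [[x [y xy]] _].
have : exists n (c : {linear g -> 'rV[F]_n}) d, cancel c d /\ cancel d c.
  by exists (dim g), v2r, r2v; split;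
    [exact: v2rK|exact: r2vK].
move=> [[|n] [c [d [cK dK]]]].
  by case/eqP: xy; apply: (can_inj cK); apply/rowP => -[].
exists n; pose ct z := (c z)^T.
have ct_lin : linear ct by move=> a u v; rewrite /ct linearP /= linearP.
pose cL := GRing.isLinear.Build F g 'cV[F]_n.+1 *:%R ct ct_lin.
pose C : {linear g -> 'cV[F]_n.+1} := HB.pack ct cL.
exists C, (fun w => d w^T); split=> w /=; rewrite /ct ?trmxK ?cK // dK trmxK //.
Qed.

End Coordinates.

(** * Root decomposition of a simple Lie algebra *)

Section Engel.
Variables (K : fieldType) (g : finLieAlgType K) (h : lieSubalg g).
Hypotheses (h_nilp : nilpotent_lie h) (h_norm : self_normalizing h).
Implicit Types (x y z v : g).
Local Notation hh := (h : {vspace g}).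

Lemma nilpotent_ad_nilp x y : x \in hh -> y \in hh ->
  exists m, iter m (bracket x) y = 0.
Proof.
move=> xh yh; have [m hm] := h_nilp; exists m.
suff : iter m (bracket x) y \in lower_central h m by rewrite hm memv0 => /eqP.
by elim: m {hm} => //= m IH; apply: memv_bracketv.
Qed.

(* Engel's theorem on Q / h, descending along the lower central series of h. *)
Lemma fitting_null_sub (Q : g -> Prop) :
    (forall x v, x \in hh -> Q v -> Q (bracket x v)) ->
    (forall x v, x \in hh -> Q v -> exists m, iter m (bracket x) v = 0) ->
  forall v, Q v -> v \in hh.
Proof.
move=> Qh Qnil v0 Qv0; apply/negPn/negP => v0h.
have [k hk] := h_nilp.
(* [good k] is trivial at the vanishing term of the series, while [good 0] makes [v] a normaliser of
   [h] outside [h]. *)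
pose good j v := [/\ Q v, v \notin hh &
  forall z, z \in lower_central h j -> bracket z v \in hh].
suff [v [Qv vh hv]] : exists v, good 0 v.
  case/negP: vh; apply: h_norm => y yh.
  by rewrite bracketC rpredN; apply: hv.
have : exists v, good k v.
  exists v0; split=> // z; rewrite hk memv0 => /eqP ->.
  by rewrite bracket0l mem0v.
elim: k {hk} => // j IH [v [Qv vh hv]]; apply: IH.
(* The elements of the list are treated one at a time, replacing [w] by its last [ad z]-iterate
   outside [h]. An earlier [y] keeps its property because [y, z] lies one term further down the
   series. *)
have step (s : seq g) : {subset s <= lower_central h j} ->
    exists v, good j.+1 v /\ forall z, z \in s -> bracket z v \in hh.
  elim: s => [|z s IHs] sj; first by exists v.
  have [|w [[Qw wh hw] sw]] := IHs.
    by move=> a a_s; rewrite sj // inE a_s orbT.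
  have zj : z \in lower_central h j by rewrite sj ?mem_head.
  have zh := lower_central_sub zj.
  pose P i := iter i (bracket z) w \in hh.
  have exP : exists i, P i.
    by have [m wm] := Qnil z w zh Qw; exists m; rewrite /P wm mem0v.
  have [[|m] Pm Pmin] := ex_minnP exP; first by rewrite /P /= (negPf wh) in Pm.
  pose w' i := iter i (bracket z) w.
  have [Qw' hw' sw'] : [/\ Q (w' m), forall y, y \in lower_central h j.+1 ->
       bracket y (w' m) \in hh & forall y, y \in s -> bracket y (w' m) \in hh].
    elim: m {Pm Pmin} => [//|m [Q1 H1 S1]]; split=> /=.
    - exact: Qh.
    - move=> y yj; rewrite bracket_derivation rpredD //.
        by apply: H1; rewrite bracketC rpredN; apply: lower_central_ideal.
      by apply: lieSubalg_bracket => //; apply: H1.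
    - move=> y ys; have yj : y \in lower_central h j by rewrite sj // inE ys orbT.
      rewrite bracket_derivation rpredD //.
        by apply: H1; apply: memv_bracketv => //; apply: lower_central_sub yj.
      by apply: lieSubalg_bracket => //; apply: S1.
  exists (w' m); split; first split=> //.
    by apply/negP => /Pmin; rewrite ltnn.
  by move=> y; rewrite inE => /orP[/eqP->|/sw' //]; apply: Pm.
have [|w [[Qw wh hw] sw]] := step (vbasis (lower_central h j)).
  by move=> a; apply: vbasis_mem.
exists w; split=> // z zj; rewrite (coord_vbasis zj) bracket_suml rpred_sum // => i _.
by rewrite bracketZl rpredZ // sw // mem_nth ?size_tuple.
Qed.
End Engel.

(** * Weights of [h], nondegeneracy and diagonalisability *)

Section RootDecomposition.
Variables (F : numClosedFieldType) (g : finLieAlgType F) (h : lieSubalg g) (n : nat).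
Variables (c : {linear g -> 'cV[F]_n.+1}) (d : 'cV[F]_n.+1 -> g).
Hypotheses (cK : cancel c d) (dK : cancel d c).
Hypotheses (g_simple : simple_lie g) (h_nilp : nilpotent_lie h)
  (h_norm : self_normalizing h).
Implicit Types (x y z u v : g) (e f : 'M[F]_n.+1).
Local Notation hh := (h : {vspace g}).
Local Notation A := (admx c d).
Local Notation kappa := (killing c d).

Definition ad_h (X : 'M[F]_n.+1) := exists2 x, x \in hh & X = A x.

Lemma iter_commr_admx m x y : iter m (commr (A x)) (A y) = A (iter m (bracket x) y).
Proof. by elim: m => //= m ->; rewrite admx_bracket. Qed.

Lemma admx0 : A 0 = 0.
Proof. by apply: (mx_coordP dK) => y; rewrite admxE // bracket0l linear0 mul0mx. Qed.

Lemma ad_h_nilp X Y : ad_h X -> ad_h Y -> exists m, iter m (commr X) Y = 0.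
Proof.
move=> [x xh ->] [y yh ->]; have [m hm] := nilpotent_ad_nilp h_nilp xh yh.
by exists m; rewrite iter_commr_admx hm admx0.
Qed.

Variable s : seq 'M[F]_n.+1.
Hypotheses (s_uniq : uniq s) (s_prim : forall e, e \in s -> primary ad_h e)
  (s_orth : {in s &, forall e f, e != f -> e * f = 0}) (s_sum : \sum_(e <- s) e = 1).

(** For [x] in [h] this is the only eigenvalue of [ad x] on the image of [e], written as an average
    so that linearity in [x] needs no commutativity of [h]. *)
Definition wt e x := \tr (A x * e) / \tr e.

Lemma s_idem e : e \in s -> e * e = e. Proof. by case/s_prim. Qed.

Lemma s_comm e x : e \in s -> x \in hh -> A x * e = e * A x.
Proof. by case/s_prim => _ _ + _ xh; apply; exists x. Qed.

Lemma tr_gt0 e : e \in s -> 0 < \tr e.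
Proof.
move=> es; have [ee e0 _ _] := s_prim es.
by rewrite mxtrace_idem // ltr0n lt0n mxrank_eq0.
Qed.

Lemma tr_neq0 e : e \in s -> \tr e != 0.
Proof. by move=> /tr_gt0/lt0r_neq0. Qed.

Lemma wt_linear e : scalar (wt e).
Proof.
have Al := admx_linear cK dK.
by move=> a x y; rewrite /wt Al mulrDl mxtraceD -scalerAl mxtraceZ mulrDl mulrA.
Qed.

Lemma wt_tr e x : e \in s -> \tr (A x * e) = wt e x * \tr e.
Proof. by move=> es; rewrite /wt divfK ?tr_neq0. Qed.

Lemma scalar_mxMl b (Z : 'M[F]_n.+1) : b%:M * Z = b *: Z.
Proof. exact: mul_scalar_mx. Qed.

Lemma scalar_mxMr b (Z : 'M[F]_n.+1) : Z * b%:M = b *: Z.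
Proof. exact: mul_mx_scalar. Qed.

Lemma idem_powM (X e : 'M[F]_n.+1) k : X * e = e * X -> e * e = e ->
  (X * e) ^+ k * e = X ^+ k * e.
Proof.
move=> Xe ee; elim: k => [|k IH]; first by rewrite !expr0.
have step : (X * e) ^+ k * (X * e) = (X * e) ^+ k * e * X by rewrite -mulrA -Xe.
by rewrite exprSr -mulrA -(mulrA X) ee step IH -mulrA -Xe mulrA -exprSr.
Qed.

Lemma idem_nilp (X e : 'M[F]_n.+1) k : X * e = e * X -> e * e = e ->
  X ^+ k * e = 0 -> (X * e) ^+ k.+1 = 0.
Proof.
move=> Xe ee Xk; rewrite exprSr [X in _ * X]Xe mulrA idem_powM //.
by rewrite Xk mul0r.
Qed.

Lemma shift_comm e x b : e \in s -> x \in hh -> (A x - b%:M) * e = e * (A x - b%:M).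
Proof.
move=> es xh; rewrite mulrBl mulrBr s_comm //; congr (_ - _).
by rewrite scalar_mxMl scalar_mxMr.
Qed.

Lemma wt_nilp e x : e \in s -> x \in hh -> exists k, (A x - (wt e x)%:M) ^+ k * e = 0.
Proof.
move=> es xh; have [ee e0 _ prim] := s_prim es.
have [|b [k bk]] := prim (A x); first by exists x.
exists k; suff -> : wt e x = b by [].
have : \tr ((A x - b%:M) * e) = 0.
  exact: mxtrace_nilp (idem_nilp (shift_comm b es xh) ee bk).
rewrite mulrBl scalar_mxMl linearB linearZ /= wt_tr // -mulrBl.
by move/eqP; rewrite mulf_eq0 (negPf (tr_neq0 es)) orbF subr_eq0 => /eqP.
Qed.

Lemma wt_bracket e x y : e \in s -> x \in hh -> y \in hh -> wt e (bracket x y) = 0.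
Proof.
move=> es xh yh; rewrite /wt admx_bracket // /commr mulrBl linearB /=.
rewrite -mulrA -(mulrA (A y)) (s_comm es xh) (mulrA (A y)).
suff -> : \tr (A x * (A y * e)) = \tr (A y * e * A x) by rewrite subrr mul0r.
exact: mxtrace_mulC.
Qed.

(** On the image of [e] the operator [ad x] minus its weight is nilpotent, hence so is its square;
    expand the trace 0 of that square. *)
Lemma tr_sqr e x : e \in s -> x \in hh -> \tr (A x * A x * e) = wt e x ^+ 2 * \tr e.
Proof.
move=> es xh; have [k hk] := wt_nilp es xh; set a := wt e x in hk *.
have ee := s_idem es; have Xe := shift_comm a es xh; set X := _ - _ in hk Xe.
have : \tr (X * X * e) = 0.
  apply: (@mxtrace_nilp _ _ _ k.+1); apply: idem_nilp => //.
    by rewrite -mulrA Xe mulrA Xe mulrA.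
  rewrite exprMn_comm // -mulrA hk mulr0 //.
have -> : X * X * e = A x * A x * e - (2 * a) *: (A x * e) + (a ^+ 2) *: e.
  rewrite /X !mulrBr !mulrBl !scalar_mxMl !scalar_mxMr -!scalerAl scalar_mxMl scalerA.
  by rewrite opprB addrACA -opprD -scalerDl mulr_natl mulr2n -expr2 [RHS]addrAC.
rewrite linearD linearB !linearZ /= wt_tr // -/a => H.
by apply/eqP; rewrite -subr_eq0 -[X in _ == X]H; apply/eqP; ring.
Qed.

(** By Leibniz [ad u] carries the image of [e2] into the generalised eigenspace for the sum of the
    weights of [e1] and [e2]. A nonzero part of it under [e3] would otherwise belong to two distinct
    eigenvalues. *)
Lemma wt_shift e1 e2 e3 u : e1 \in s -> e2 \in s -> e3 \in s ->
    e1 *m c u = c u -> e3 * A u * e2 != 0 ->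
  forall x, x \in hh -> wt e3 x = wt e1 x + wt e2 x.
Proof.
move=> e1s e2s e3s ue nz x xh; apply/eqP; apply: contraNT nz => neq.
have [i hi] := wt_nilp e1s xh; have [j hj] := wt_nilp e2s xh.
have [k hk] := wt_nilp e3s xh.
set a := wt e1 x in hi neq; set b := wt e2 x in hj neq.
have ui : iter i (fun Z => commr (A x) Z - a *: Z) (A u) = 0.
  have -> : iter i (fun Z => commr (A x) Z - a *: Z) (A u) =
      A (iter i (fun z => bracket x z - a *: z) u).
    have AB t y z : A (y - t *: z) = A y - t *: A z.
      by rewrite addrC -scaleNr (admx_linear cK dK) scaleNr addrC.
    by elim: i {hi} => //= i ->; rewrite AB admx_bracket.
  suff -> : iter i (fun z => bracket x z - a *: z) u = 0 by exact: admx0.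
  apply: (can_inj cK); rewrite linear0.
  have -> : c (iter i (fun z => bracket x z - a *: z) u) = (A x - a%:M) ^+ i *m c u.
    elim: i {hi} => [|i IH]; first by rewrite expr0 mul1mx.
    rewrite iterS linearB linearZ /= IH exprS -mulmxE -mulmxA mulmxBl mul_scalar_mx.
    by rewrite -IH admxE.
  by rewrite -ue mulmxA mulmxE hi mul0mx.
have hW := leibniz_nilp ui hj.
have c3 := shift_comm _ e3s xh.
apply/eqP; apply: (eigen_pow_disjoint neq (j := k) (k := (i + j)%N) (X := A x)).
  by rewrite !mulmxE !mulrA hk !mul0r.
have c3N : e3 * (A x - (a + b)%:M) ^+ (i + j) = (A x - (a + b)%:M) ^+ (i + j) * e3.
  exact/commrX/esym.
by rewrite mulmxE -(mulrA e3) (mulrA _ e3) -c3N -mulrA hW mulr0.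
Qed.

Definition root_proj e u := d (e *m c u).

Lemma root_projE e u : e \in s -> e *m c (root_proj e u) = c (root_proj e u).
Proof. by move=> es; rewrite /root_proj dK mulmxA mulmxE s_idem. Qed.

Lemma root_proj_sum u : \sum_(e <- s) root_proj e u = u.
Proof.
apply: (can_inj cK); rewrite linear_sum /= -[RHS]mul1mx.
have -> : 1%:M = \sum_(e <- s) e by rewrite s_sum.
by rewrite mulmx_suml; apply: eq_bigr => e _; rewrite dK.
Qed.

Definition zero_wt e := `[< forall x, x \in hh -> wt e x = 0 >].

Definition zero_proj : 'M[F]_n.+1 := \sum_(e <- s | zero_wt e) e.

Lemma s_zero_proj e : e \in s -> e * zero_proj = if zero_wt e then e else 0.
Proof.
move=> es; rewrite /zero_proj mulr_sumr big_mkcond (bigD1_seq e) //= s_idem //.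
rewrite big1_seq ?addr0 // => f /andP[fe fs]; case: ifP => // _.
by rewrite s_orth // eq_sym.
Qed.

Lemma zero_proj_comm x : x \in hh -> A x * zero_proj = zero_proj * A x.
Proof.
move=> xh; rewrite /zero_proj mulr_sumr mulr_suml big_seq_cond [RHS]big_seq_cond.
by apply: eq_bigr => e /andP[es _]; rewrite s_comm.
Qed.

Lemma zero_proj_nilp x : x \in hh -> exists k, A x ^+ k * zero_proj = 0.
Proof.
move=> xh; rewrite /zero_proj.
have : {subset s <= s} by [].
elim: {1 3}s => [|e r IH] rs; first by exists 0; rewrite big_nil mulr0.
have [|k hk] := IH; first by move=> f fr; rewrite rs // inE fr orbT.
rewrite big_cons; case: ifP => [/asboolP e0|_]; last by exists k.
have es : e \in s by rewrite rs ?mem_head.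
have [j] := wt_nilp es xh; rewrite e0 // raddf0 subr0 => hj.
exists (k + j)%N; rewrite mulrDr {2}addnC !exprD -!mulrA hj hk.
by rewrite !mulr0 addr0.
Qed.

(** Engel's argument and self-normalisation put the zero weight space inside [h]. Conversely [ad x]
    is nilpotent on [h], which leaves elements of [h] no component of nonzero weight. *)
Lemma zero_proj_h u : zero_proj *m c u = c u <-> u \in hh.
Proof.
split=> [|uh].
  apply: (fitting_null_sub h_nilp h_norm (Q := fun u => zero_proj *m c u = c u)) => x v xh hv.
    by rewrite -(admxE cK dK) mulmxA mulmxE -zero_proj_comm // -mulmxE -mulmxA hv.
  have [k hk] := zero_proj_nilp xh; exists k; apply: (can_inj cK); rewrite linear0.
  have -> : c (iter k (bracket x) v) = A x ^+ k *m c v.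
    elim: k {hk} => [|k IH]; first by rewrite expr0 mul1mx.
    by rewrite iterS -(admxE cK dK) IH exprS -mulmxE mulmxA.
  by rewrite -hv mulmxA mulmxE hk mul0mx.
rewrite -[RHS]mul1mx; have -> : 1%:M = \sum_(e <- s) e by rewrite s_sum.
rewrite (bigID zero_wt) /= mulmxDl -[LHS]addr0; congr (_ + _).
rewrite mulmx_suml big1_seq // => e /andP[+ es].
move=> /asboolP/existsNP[x /not_implyP[xh /eqP ex0]].
have [k hk] := wt_nilp es xh.
have [j hj] := nilpotent_ad_nilp h_nilp xh uh.
apply: (eigen_pow_disjoint ex0 (j := k) (k := j) (X := A x)).
  by rewrite mulmxA mulmxE hk mul0mx.
rewrite raddf0 subr0 mulmxA mulmxE -(commrX j (esym (s_comm es xh))) -mulmxE -mulmxA.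
have -> : A x ^+ j *m c u = c (iter j (bracket x) u).
  elim: j {hj} => [|j IH]; first by rewrite expr0 mul1mx.
  by rewrite iterS -(admxE cK dK) -IH exprS -mulmxE mulmxA.
by rewrite hj linear0 mulmx0.
Qed.
Lemma mx_sum_s (M : 'M[F]_n.+1) : M = \sum_(e <- s) M * e.
Proof. by rewrite -mulr_sumr s_sum mulr1. Qed.

Lemma killing_sqr x : x \in hh -> kappa x x = \sum_(e <- s) wt e x ^+ 2 * \tr e.
Proof.
move=> xh; rewrite /killing [X in \tr X]mx_sum_s raddf_sum /= big_seq [RHS]big_seq.
by apply: eq_bigr => e es; rewrite tr_sqr.
Qed.

Lemma col_bracket e1 e2 e3 u v : e1 \in s -> e2 \in s -> e3 \in s ->
    e1 *m c u = c u -> e2 *m c v = c v -> e3 *m c (bracket u v) != 0 ->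
  forall x, x \in hh -> wt e3 x = wt e1 x + wt e2 x.
Proof.
move=> e1s e2s e3s ue ve nz; apply: (wt_shift e1s e2s e3s ue).
apply: contra nz => /eqP H.
by rewrite -(admxE cK dK) -ve !mulmxA !mulmxE H mul0mx.
Qed.

Definition opposite e1 e2 := `[< forall x, x \in hh -> wt e1 x + wt e2 x = 0 >].

Lemma zero_proj_bracket e1 e2 u v : e1 \in s -> e2 \in s ->
    e1 *m c u = c u -> e2 *m c v = c v ->
  zero_proj *m c (bracket u v) = if opposite e1 e2 then c (bracket u v) else 0.
Proof.
move=> e1s e2s ue ve; have col := col_bracket e1s e2s _ ue ve.
case: ifP => [/asboolP opp|/asboolP nopp]; last first.
  rewrite mulmx_suml big1_seq // => e /andP[/asboolP e0 es]; apply/eqP.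
  apply: contraT => nz; have e3 := col _ es nz; case: nopp => x xh.
  by rewrite -e3 // e0.
rewrite -[RHS]mul1mx; have -> : 1%:M = \sum_(e <- s) e by rewrite s_sum.
rewrite (bigID zero_wt) /= mulmxDl -[LHS]addr0; congr (_ + _).
rewrite mulmx_suml big1_seq // => e /andP[/asboolP e0 es]; apply/esym/eqP.
apply: contraT; rewrite eq_sym => nz; have e3 := col _ es nz; case: e0 => x xh.
by rewrite e3 // opp.
Qed.

(* The commutator of ad u and ad v has trace 0 on the sum of the weight spaces
   in the e1-string through e, where its trace also is M wt e + r wt e1 with
   M > 0 and r real. *)
Lemma root_string e1 e2 u v : e1 \in s -> e2 \in s ->
    e1 *m c u = c u -> e2 *m c v = c v -> opposite e1 e2 ->
    bracket u v \in hh ->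
  forall e, e \in s -> exists2 q, q \is Num.real & wt e (bracket u v) = q * wt e1 (bracket u v).
Proof.
move=> e1s e2s ue ve /asboolP opp xh e0 e0s; set x := bracket u v in xh *.
(* The full coset of the weight of [e0] modulo integer multiples of that of [e1]: the shifts made by
   [ad u] and [ad v] never leave it. *)
pose T f := `[< exists z : int, forall y, y \in hh -> wt f y = wt e0 y + z%:~R * wt e1 y >].
pose Q : 'M[F]_n.+1 := \sum_(f <- s | T f) f.
(* [ad w] commutes with [Q] once none of its nonzero blocks joins a weight of the string to one
   outside it. *)
have commQ w : (forall f f', f \in s -> f' \in s -> f' * A w * f != 0 -> T f = T f') ->
    A w * Q = Q * A w.
  move=> hT.
  have QA : Q * A w = \sum_(f' <- s | T f') \sum_(f <- s | T f) f' * A w * f.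
    rewrite /Q mulr_suml big_seq_cond [RHS]big_seq_cond.
    apply: eq_bigr => f' /andP[f's Tf']; rewrite [LHS]mx_sum_s (bigID T) /=.
    rewrite [X in _ + X]big1_seq ?addr0 // => f /andP[nT fs]; apply/eqP.
    by apply: contraNT nT => /(hT _ _ fs f's) ->.
  rewrite QA exchange_big /= mulr_sumr big_seq_cond [RHS]big_seq_cond.
  apply: eq_bigr => f /andP[fs Tf].
  rewrite -[LHS]mul1r -s_sum mulr_suml (bigID T) /= [X in _ + X]big1_seq ?addr0.
    by apply: eq_bigr => f' _; rewrite mulrA.
  move=> f' /andP[nT f's]; apply/eqP; rewrite mulrA.
  by apply: contraNT nT => /(hT _ _ fs f's) <-.
have cu : A u * Q = Q * A u.
  apply: commQ => f f' fs f's nz; have sh := wt_shift e1s fs f's ue nz.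
  apply/asboolP/asboolP => -[z hz].
    by exists (z + 1) => y yh; rewrite sh // hz // intrD; ring.
  exists (z - 1) => y yh; have := hz y yh; rewrite sh // => /(canRL (addKr _)) ->.
  by rewrite intrB; ring.
have cv : A v * Q = Q * A v.
  apply: commQ => f f' fs f's nz; have sh := wt_shift e2s fs f's ve nz.
  have op y : y \in hh -> wt e2 y = - wt e1 y.
    by move=> /opp/eqP; rewrite addrC addr_eq0 => /eqP.
  apply/asboolP/asboolP => -[z hz].
    by exists (z - 1) => y yh; rewrite sh // hz // op // intrB; ring.
  exists (z + 1) => y yh; have := hz y yh; rewrite sh // => /(canRL (addKr _)) ->.
  by rewrite op // intrD; ring.
have trQ : \tr (A x * Q) = 0.
  rewrite /x admx_bracket // /commr mulrBl linearB /= -(mulrA (A v)) cu.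
  have -> : \tr (A v * (Q * A u)) = \tr (Q * A u * A v) by exact: mxtrace_mulC.
  by rewrite -cu -(mulrA (A u) Q) -cv mulrA subrr.
have {trQ} sum0 : \sum_(f <- s | T f) wt f x * \tr f = 0.
  apply: etrans trQ; rewrite /Q mulr_sumr raddf_sum /= big_seq_cond [RHS]big_seq_cond.
  by apply: eq_bigr => f /andP[fs _]; rewrite wt_tr.
pose m := \sum_(f <- s | T f) \tr f.
have Te0 : T e0 by apply/asboolP; exists 0 => y _; rewrite mul0r addr0.
have m0 : 0 < m.
  rewrite /m big_mkcond (bigD1_seq e0) //= Te0 ltr_wpDr ?tr_gt0 //.
  by rewrite big_seq_cond; apply: sumr_ge0 => f /andP[fs _]; case: ifP => // _; rewrite ltW ?tr_gt0.
have [r rR rE] : exists2 r, r \is Num.real &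
    \sum_(f <- s | T f) wt f x * \tr f = wt e0 x * m + r * wt e1 x.
  rewrite /m big_seq_cond [X in _ * X]big_seq_cond.
  elim/big_rec2: _ => [|f m' S /andP[fs /asboolP[z hz]] [r rR ->]].
    by exists 0; rewrite ?rpred0 // mulr0 mul0r addr0.
  exists (z%:~R * \tr f + r); first by rewrite rpredD // rpredM ?realz // gtr0_real ?tr_gt0.
  by rewrite hz //; ring.
exists (- r / m); first by rewrite rpredM ?rpredN ?rpredV // gtr0_real.
move: rE; rewrite sum0 => /esym/eqP; rewrite addr_eq0 => /eqP H.
by rewrite mulrAC mulNr -H mulfK // lt0r_neq0.
Qed.

(** If the weight of [e1] at [x], the bracket of [u] and [v], is nonzero, dividing the Killing
    square of [x] by the square of this weight writes 0 as a sum of nonnegative reals: squares of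
    real ratios times positive multiplicities. *)
Lemma root_string_isotropic e1 e2 u v : e1 \in s -> e2 \in s ->
    e1 *m c u = c u -> e2 *m c v = c v -> opposite e1 e2 ->
    bracket u v \in hh -> kappa (bracket u v) (bracket u v) = 0 ->
  forall e, e \in s -> wt e (bracket u v) = 0.
Proof.
move=> e1s e2s ue ve opp xh k0.
have str := root_string e1s e2s ue ve opp xh; set x := bracket u v in xh k0 str *.
have [w0|w1] := eqVneq (wt e1 x) 0.
  by move=> e /str[q _ ->]; rewrite w0 mulr0.
have ratio e : e \in s -> 0 <= (wt e x / wt e1 x) ^+ 2 * \tr e.
  move=> es; have [q qR ->] := str e es; rewrite mulfK //.
  by rewrite mulr_ge0 ?(ltW (tr_gt0 es)) // real_exprn_even_ge0.
have : \sum_(e <- s) (wt e x / wt e1 x) ^+ 2 * \tr e = 0.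
  transitivity (kappa x x / wt e1 x ^+ 2); last by rewrite k0 mul0r.
  rewrite killing_sqr // mulr_suml; apply: eq_bigr => e _.
  by rewrite expr_div_n mulrAC.
rewrite big_seq => /eqP; rewrite psumr_eq0 // => /allP all0 e es.
have := all0 e es; rewrite es /= mulf_eq0 (negPf (tr_neq0 es)) orbF expf_eq0 /=.
by rewrite mulf_eq0 invr_eq0 (negPf w1) orbF => /eqP.
Qed.

(** If the form vanished, [root_string_isotropic] would apply to all opposite pairs. By perfection
    of g every weight would then vanish on [h], the zero weight space would be all of g, and g would
    be both nilpotent and perfect. *)
Lemma killing_neq0 : exists x y, kappa x y != 0.
Proof.
apply: contrapT => nex.
have k0 x y : kappa x y = 0.
  by apply/eqP/negPn/negP => k; apply: nex; exists x, y.
have wt0 u e : e \in s -> wt e (d (zero_proj *m c u)) = 0.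
  move=> es.
  have dl := coord_inv_linear cK dK.
  have lin a x y : d (zero_proj *m c (a *: x + y)) =
      a *: d (zero_proj *m c x) + d (zero_proj *m c y).
    by rewrite linearP mulmxDr -scalemxAr dl.
  have wl := wt_linear e.
  have d0 : d (zero_proj *m c 0) = 0.
    by apply: (can_inj cK); rewrite dK !linear0.
  have w0 : wt e 0 = 0 by rewrite /wt admx0 mul0r mxtrace0 mul0r.
  have wsum (I : eqType) (r : seq I) (f : I -> g) :
      (forall i, i \in r -> wt e (d (zero_proj *m c (f i))) = 0) ->
      wt e (d (zero_proj *m c (\sum_(i <- r) f i))) = 0.
    elim: r => [|i r IH] H; first by rewrite big_nil d0.
    rewrite big_cons -[f i]scale1r lin wl H ?mem_head // mulr0 add0r IH // => j jr.
    by rewrite H // inE jr orbT.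
  have : u \in bracketv (fullv : {vspace g}) fullv by rewrite simple_perfect ?memvf.
  apply: (bracketv_ind (Q := fun u => wt e (d (zero_proj *m c u)) = 0)) => [|a x y hx hy|x y _ _].
  - by rewrite d0.
  - by rewrite lin wl hx hy mulr0 addr0.
  - rewrite -(root_proj_sum x) -(root_proj_sum y) bracket_suml; apply: (wsum) => e1 e1s.
    rewrite linear_sum; apply: wsum => e2 e2s /=.
    have zero_projb := zero_proj_bracket e1s e2s (root_projE x e1s) (root_projE y e2s).
    rewrite zero_projb; case: ifP => [opp|_]; last by rewrite -(mulmx0 _ zero_proj) -(linear0 c) d0.
    rewrite cK; apply: (root_string_isotropic e1s e2s (root_projE x e1s) (root_projE y e2s)) => //.
    by apply/zero_proj_h; rewrite zero_projb opp.
have zero_proj1 : zero_proj = 1.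
  rewrite -s_sum /zero_proj big_mkcond; apply: eq_big_seq => e es.
  rewrite (_ : zero_wt e) //; apply/asboolP => x /zero_proj_h xh.
  by rewrite -(cK x) -xh wt0.
have hfull : hh = fullv.
  by apply/vspaceP => x; rewrite memvf; apply/zero_proj_h; rewrite zero_proj1 mul1mx.
have [k hk] := h_nilp; have := simple_perfect g_simple => perf.
have full0 : fullv = 0%VS :> {vspace g}.
  by rewrite -hk hfull; elim: k {hk} => //= k <-; rewrite perf.
have [[x [y xy]] _] := g_simple.
by have := memvf (bracket x y); rewrite full0 memv0 (negPf xy).
Qed.

Let kappa_nondeg := killing_nondeg cK dK g_simple killing_neq0.

Lemma tr_mul_root (M : 'M[F]_n.+1) e u : {in s, forall f, M * f = f * M} ->
  e \in s -> ~~ zero_wt e -> e *m c u = c u -> \tr (M * A u) = 0.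
Proof.
move=> cM es nz ue; rewrite [X in \tr X]mx_sum_s raddf_sum /=.
apply: big1_seq => f /= fs.
have -> : \tr (M * A u * f) = \tr (M * (f * A u * f)).
  rewrite -{1}(s_idem fs) mulrA.
  have -> : \tr (M * A u * f * f) = \tr (f * (M * A u * f)) by exact: mxtrace_mulC.
  by rewrite !mulrA cM.
suff -> : f * A u * f = 0 by rewrite mulr0 mxtrace0.
apply/eqP; apply: contraNT nz => nz; apply/asboolP => x xh.
have /esym/eqP := wt_shift es fs fs ue nz xh.
by rewrite -subr_eq0 addrK => /eqP.
Qed.

(** [M] is block diagonal, whereas [ad u] for [u] of nonzero weight shifts weights and has no
    diagonal block; only the component of [u] in [h] contributes. *)
Lemma tr_mul_ad0 (M : 'M[F]_n.+1) : {in s, forall f, M * f = f * M} ->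
  (forall x, x \in hh -> \tr (M * A x) = 0) -> forall u, \tr (M * A u) = 0.
Proof.
move=> cM Mh u; rewrite -(root_proj_sum u).
have -> : A (\sum_(e <- s) root_proj e u) = \sum_(e <- s) A (root_proj e u).
  elim/big_rec2: _ => [|e S x _ <-]; first exact: admx0.
  by rewrite -[root_proj e u]scale1r (admx_linear cK dK) !scale1r.
rewrite mulr_sumr raddf_sum /=; apply: big1_seq => e /= es.
have [z|nz] := boolP (zero_wt e); last exact: tr_mul_root cM es nz (root_projE u es).
apply/Mh/zero_proj_h; rewrite -root_projE // mulmxA mulmxE.
have := s_zero_proj es; rewrite z => eP.
suff -> : zero_proj * e = e by [].
rewrite /zero_proj mulr_suml big_mkcond (bigD1_seq e) //= z s_idem // big1_seq ?addr0 //.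
by move=> f /andP[fe fs]; case: ifP => // _; rewrite s_orth.
Qed.

(** Polarisation of [killing_sqr]: the trace of a product of two different elements of [ad h] is not
    directly accessible while they are not known to commute. *)
Lemma killing_h x y : x \in hh -> y \in hh ->
  kappa x y = \sum_(e <- s) wt e x * wt e y * \tr e.
Proof.
move=> xh yh; have xyh : x + y \in hh by rewrite rpredD.
have two : (2 : F) != 0 by rewrite pnatr_eq0.
apply: (mulfI two).
have -> : 2 * kappa x y = kappa (x + y) (x + y) - kappa x x - kappa y y.
  have KD := killingDl cK dK; rewrite KD (killingC c d x (x + y)).
  rewrite (killingC c d y (x + y)) !KD (killingC c d y x).
  by move: (kappa x x) (kappa x y) (kappa y y) => a b b'; ring.
rewrite !killing_sqr // mulr_sumr -!sumrB; apply: eq_bigr => e _.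
have -> : wt e (x + y) = wt e x + wt e y by rewrite -[x]scale1r wt_linear scale1r mul1r.
by ring.
Qed.

(** All weights vanish on a commutator of elements of [h], being traces of commutators, so it is
    Killing-orthogonal to [h] and then to g. *)
Lemma cartan_abelian x y : x \in hh -> y \in hh -> bracket x y = 0.
Proof.
move=> xh yh; apply: kappa_nondeg; apply: tr_mul_ad0.
  by move=> f fs; rewrite s_comm //; apply: lieSubalg_bracket.
move=> z zh; rewrite -/(kappa _ _) killing_h ?lieSubalg_bracket //.
by apply: big1_seq => e /= es; rewrite wt_bracket // !mul0r.
Qed.

(* N, the nilpotent part of ad x, is a derivation with tr (N ad u) = 0 for all
   u, so killing (N u) w = tr (N ad [u, w]) = 0 and N = 0 by nondegeneracy. *)
Lemma cartan_diagonal x : x \in hh -> A x = \sum_(e <- s) wt e x *: e.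
Proof.
move=> xh; pose D : 'M[F]_n.+1 := \sum_(e <- s) wt e x *: e.
have De e : e \in s -> D * e = wt e x *: e.
  move=> es; rewrite /D mulr_suml (bigD1_seq e) //= -scalerAl s_idem // big1_seq ?addr0 //.
  by move=> f /andP[fe fs]; rewrite -scalerAl s_orth ?scaler0.
have eD e : e \in s -> e * D = wt e x *: e.
  move=> es; rewrite /D mulr_sumr (bigD1_seq e) //= -scalerAr s_idem // big1_seq ?addr0 //.
  by move=> f /andP[fe fs]; rewrite -scalerAr s_orth ?scaler0 // eq_sym.
pose N := A x - D; suff : N = 0 by move=> /subr0_eq.
have cN : {in s, forall f, N * f = f * N}.
  by move=> f fs; rewrite /N mulrBl mulrBr s_comm // De // eD.
have nilpN : exists k, N ^+ k = 0.
  suff [k hk] : exists k, forall e, e \in s -> N ^+ k * e = 0.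
    by exists k; rewrite [LHS]mx_sum_s big1_seq // => e /= /hk.
  have : {subset s <= s} by [].
  elim: {1 3}s => [|e r IH] rs; first by exists 0.
  have [|k hk] := IH; first by move=> f fr; rewrite rs // inE fr orbT.
  have es : e \in s by rewrite rs ?mem_head.
  have [j hj] := wt_nilp es xh; exists (k + j)%N => f; rewrite inE => /orP[/eqP->|fr].
    rewrite exprD -mulrA; suff -> : N ^+ j * e = 0 by rewrite mulr0.
    rewrite -[RHS]hj; elim: j {hj} => [|j IHj]; first by rewrite !expr0.
    rewrite !exprSr -!mulrA /N mulrBl De // [in RHS]mulrBl scalar_mxMl -/N.
    rewrite -scalar_mxMl -mulrBl shift_comm // !mulrA.
    by rewrite -IHj.
  by rewrite addnC exprD -mulrA hk // mulr0.
(* For z in [h], [N] commutes with [ad z] because [h] is abelian, so their product is nilpotent and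
   has trace 0. *)
have trN u : \tr (N * A u) = 0.
  apply: tr_mul_ad0 => // z zh.
  have Nz : GRing.comm N (A z).
    rewrite /GRing.comm /N mulrBl mulrBr; congr (_ - _).
      apply: (mx_coordP dK) => w; rewrite -!mulmxE -!mulmxA !(admxE cK dK).
      by rewrite bracket_derivation (cartan_abelian xh zh) bracket0l add0r.
    rewrite /D mulr_suml mulr_sumr; apply: eq_big_seq => e es.
    by rewrite -scalerAl -scalerAr s_comm.
  have [k hk] := nilpN.
  by apply: (@mxtrace_nilp _ _ _ k); rewrite exprMn_comm // hk mul0r.
pose Dx u := d (N *m c u).
have der u : A (Dx u) = N * A u - A u * N.
  have [dl Al] := (coord_inv_linear cK dK, admx_linear cK dK).
  have Dxl a v w : Dx (a *: v + w) = a *: Dx v + Dx w.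
    by rewrite /Dx linearP mulmxDr -scalemxAr dl.
  pose good u := A (Dx u) = N * A u - A u * N.
  have good0 : good 0.
    have D0 : Dx 0 = 0 by apply: (can_inj cK); rewrite /Dx dK !linear0.
    by rewrite /good D0 admx0 mulr0 mul0r subrr.
  have goodD v w : good v -> good w -> good (v + w).
    move=> hv hw; rewrite /good -[v]scale1r Dxl Al hv hw Al !scale1r.
    by rewrite (mulrDr N) (mulrDl (A v) (A w) N) opprD addrACA.
  rewrite -/(good u) -(root_proj_sum u) big_seq; elim/big_ind: _ => // e es.
  move: (root_proj e u) (root_projE u es) => w we; rewrite /good.
  have -> : Dx w = bracket x w - wt e x *: w.
    apply: (can_inj cK); rewrite /Dx dK linearB linearZ /= -(admxE cK dK) mulmxBl.
    by congr (_ - _); rewrite -{1}we mulmxA mulmxE De // -scalemxAl we.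
  rewrite addrC -scaleNr Al admx_bracket // scaleNr addrC /commr /N !mulrBl !mulrBr.
  (* Checked block by block: on a block of [ad w] the left side multiplies by the difference of two
     weights, which is the weight of [e] wherever the block is nonzero. *)
  suff H : D * A w - A w * D = wt e x *: A w.
    rewrite -H; move: (A x * A w) (A w * A x) (D * A w) (A w * D) => m1 m2 m3 m4.
    by rewrite !opprB addrACA [RHS]addrACA; congr (_ + _); rewrite addrC.
  apply/eqP; rewrite -subr_eq0; apply/eqP; set Z := _ - _ - _.
  have Z0 f f' : f \in s -> f' \in s -> f' * Z * f = 0.
    move=> fs f's; rewrite /Z !mulrBr !mulrBl !mulrA eD // -(mulrA (f' * A w)) De //.
    rewrite -!scalerAl -!scalerAr -scalerAl -!scalerBl.
    have [->|nz] := eqVneq (f' * A w * f) 0; first by rewrite scaler0.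
    by rewrite (wt_shift es fs f's we nz xh) addrK subrr scale0r.
  rewrite [Z]mx_sum_s big1_seq // => f /= fs.
  rewrite -[LHS]mul1r -s_sum mulr_suml big1_seq // => f' /= f's.
  by rewrite mulrA Z0.
apply: (mx_coordP dK) => u; rewrite mul0mx -[LHS]dK -/(Dx u).
suff -> : Dx u = 0 by rewrite linear0.
apply: kappa_nondeg => w; rewrite /killing der mulrBl linearB /=.
have -> : \tr (A u * N * A w) = \tr (N * A w * A u).
  by rewrite -mulrA; apply: mxtrace_mulC.
by rewrite -linearB /= -!mulrA -mulrBr -/(commr (A u) (A w)) -admx_bracket.
Qed.

End RootDecomposition.

Definition weight_vector (F : fieldType) (g : finLieAlgType F) (h : lieSubalg g)
    (al : g -> F) (e : g) :=
  forall x, x \in (h : {vspace g}) -> bracket x e = al x *: e.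

(** The pieces of weight zero, which make up [h], are indexed together with the root spaces; later
    arguments tell them apart by asking whether [al i] vanishes on [h]. *)
Theorem root_decomposition (F : numClosedFieldType) (g : finLieAlgType F)
    (h : lieSubalg g) : simple_lie g -> cartan_subalgebra h ->
  (forall x y, x \in (h : {vspace g}) -> y \in (h : {vspace g}) -> bracket x y = 0) /\
  exists k (pr : 'I_k -> g -> g) (al : 'I_k -> g -> F),
    [/\ forall u, \sum_i pr i u = u, forall i u, weight_vector h (al i) (pr i u) &
     forall i, exists u, pr i u != 0].
Proof.
move=> sg [nh hh]; have [n [c [d [cK dK]]]] := coordinates sg.
have [s [s_uniq s_prim s_orth s_sum]] := primary_decomposition (ad_h_nilp cK dK nh).
split.
  exact: (cartan_abelian cK dK sg nh hh s_uniq s_prim s_orth s_sum).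
exists (size s), (fun i => root_proj c d s`_i), (fun i => wt c d s`_i); split.
- move=> u; rewrite -[RHS](root_proj_sum cK dK s_sum) (big_nth 0) big_mkord.
  by apply: eq_bigr.
- move=> i u x xh; have es : s`_i \in s by rewrite mem_nth.
  apply: (can_inj cK); rewrite linearZ /= -(admxE cK dK).
  rewrite (cartan_diagonal cK dK sg nh hh s_uniq s_prim s_orth s_sum) //.
  rewrite -(root_projE dK s_prim u es) mulmxA mulmxE mulr_suml (bigD1_seq s`_i) //=.
  rewrite big1_seq ?addr0; last first.
    by move=> f /andP[fe fs]; rewrite -scalerAl s_orth ?scaler0.
  by rewrite -scalerAl (s_idem s_prim es) -scalemxAl.
- move=> i; have [e0 si] : s`_i != 0 /\ s`_i \in s.
  by have si : s`_i \in s by [rewrite mem_nth]; have [] := s_prim _ si.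
apply: contrapT => nex; case/eqP: e0; apply: (mx_coordP dK) => y.
rewrite mul0mx; apply/eqP; apply: contraT => y0; case: nex; exists y.
by apply: contra y0 => /eqP pj0; rewrite -[_ *m _]dK -/(root_proj c d _ _) pj0 linear0.
Qed.

(** * Translations of polynomials *)

Section Shift.
Variables (F : numFieldType) (r : nat).
Local Notation P := {mpoly F[r]}.
Implicit Types (p q : P) (a : 'I_r -> F) (m : 'X_{1.. r}).

Lemma mnm_predU m : m != 0%MM -> exists i m', m = (U_(i) + m')%MM.
Proof.
move=> m0; have [i mi] : exists i, (0 < m i)%N.
  apply/existsP; apply: contraNT m0; rewrite negb_exists => /forallP m0.
  by apply/eqP/mnmP => i; rewrite mnm0E; have := m0 i; rewrite -eqn0Ngt => /eqP.
exists i, (m - U_(i))%MM; rewrite addmC submK //.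
by apply/mnm_lepP => j; rewrite mnm1E; case: eqP => // <-.
Qed.

Lemma mpoly_alg_ind (Q : P -> Prop) : (forall c, Q c%:MP) ->
    (forall p q, Q p -> Q q -> Q (p + q)) -> (forall i p, Q p -> Q ('X_i * p)) ->
  forall p, Q p.
Proof.
move=> QC QD QX; elim/mpolyind => [|c m p _ _ Qp]; first by rewrite -mpolyC0.
apply: QD => //; move dm: (mdeg m) => k; elim: k m dm => [|k IH] m dm.
  by have /eqP := dm; rewrite mdeg_eq0 => /eqP ->; rewrite mpolyX0 -mul_mpolyC mulr1.
have [|i [m' mE]] := @mnm_predU m; first by rewrite -mdeg_eq0 dm.
have -> : c *: 'X_[m] = 'X_i * (c *: 'X_[m']) :> P.
  by rewrite -!mul_mpolyC mE mpolyXD mulrCA.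
by apply/QX/IH; move: dm; rewrite mE mdegD mdeg1 => -[].
Qed.

Definition mshift a p : P := p \mPo [tuple 'X_i - (a i)%:MP | i < r].

Lemma mshiftC a c : mshift a c%:MP = c%:MP.
Proof. exact: comp_mpolyC. Qed.

Lemma mshiftX a i : mshift a 'X_i = 'X_i - (a i)%:MP.
Proof. by rewrite /mshift comp_mpolyXU -tnth_nth tnth_mktuple. Qed.

Lemma mshiftD a p q : mshift a (p + q) = mshift a p + mshift a q.
Proof. exact: comp_mpolyD. Qed.

Lemma mshiftB a p q : mshift a (p - q) = mshift a p - mshift a q.
Proof. exact: comp_mpolyB. Qed.

Lemma mshiftM a p q : mshift a (p * q) = mshift a p * mshift a q.
Proof. by rewrite /mshift rmorphM. Qed.

Lemma mshiftK a : cancel (mshift a) (mshift (fun i => - a i)).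
Proof.
elim/mpoly_alg_ind => [c|p q hp hq|i p hp]; first by rewrite !mshiftC.
  by rewrite !mshiftD hp hq.
by rewrite !mshiftM hp mshiftX mshiftB mshiftC mshiftX mpolyCN opprK addrK.
Qed.

Lemma mshift_eq0 a p : (mshift a p == 0) = (p == 0).
Proof.
have s0 b : mshift b 0 = 0 by rewrite -mpolyC0 mshiftC.
apply/eqP/eqP => [p0|->]; last exact: s0.
by rewrite -(mshiftK a p) p0 s0.
Qed.

Lemma mderivXU i j : mderiv i ('X_j : P) = (i == j)%:R%:MP.
Proof.
apply/mpolyP => m; rewrite mcoeff_deriv mcoeffX mcoeffC.
have [->|m0] := eqVneq m 0%MM.
  by rewrite add0m eq_mnm1 mnm0E mulr1 mulr1n eq_sym.
rewrite mulr0 (_ : _ == _ = false) ?mul0rn //; apply/negP => /eqP/(congr1 (@mdeg r)).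
by rewrite mdegD !mdeg1 addn1 => -[] /esym/eqP; rewrite mdeg_eq0 (negPf m0).
Qed.

Lemma mshift_deriv a i p : (mshift a p)^`M(i) = mshift a p^`M(i).
Proof.
elim/mpoly_alg_ind: p => [c|p q hp hq|j p hp].
- by rewrite mshiftC mderivC -mpolyC0 mshiftC.
- by rewrite mshiftD !mderivD mshiftD hp hq.
by rewrite !mshiftM !mderivM mshiftD !mshiftM hp mshiftX mderivB mderivC subr0 mderivXU mshiftC.
Qed.

Lemma msize_mderiv p i : p != 0 -> (msize p^`M(i) < msize p)%N.
Proof.
move=> p0; rewrite [msize _^`M(i)]msizeE.
have : (0 < msize p)%N by rewrite lt0n mmeasure_poly_eq0.
case E: (msize p) => [//|k] _; rewrite ltnS big_seq.
elim/big_ind: _ => // [x y hx hy|m]; first by rewrite geq_max hx.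
rewrite mcoeff_msupp mcoeff_deriv => nz.
have : (m + U_(i))%MM \in msupp p.
  by rewrite mcoeff_msupp; apply: contraNneq nz => ->; rewrite mul0rn.
by move=> /msize_mdeg_lt; rewrite E mdegD mdeg1 addn1 ltnS.
Qed.

(** Translation fixes the top-degree part. On a monomial 'X_i m' the difference is 'X_i times the
    difference for m', minus [a i] times the translate of m', which gives an induction on the
    degree. *)
Lemma msize_mshift_sub a p : p != 0 -> (msize (mshift a p - p) < msize p)%N.
Proof.
move=> p0; have : (0 < msize p)%N by rewrite lt0n mmeasure_poly_eq0.
have mono k m : mdeg m = k -> (msize (mshift a 'X_[m] - 'X_[m]) <= k)%N.
  elim: k m => [|k IH] m dm.
    have /eqP := dm; rewrite mdeg_eq0 => /eqP ->.
    by rewrite mpolyX0 -mpolyC1 mshiftC subrr mmeasure0.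
  have [|i [m' mE]] := @mnm_predU m; first by rewrite -mdeg_eq0 dm.
  have dm' : mdeg m' = k by move: dm; rewrite mE mdegD mdeg1 => -[].
  rewrite mE mpolyXD mshiftM mshiftX.
  rewrite mulrBl addrAC -mulrBr -mulNr -mpolyCN mul_mpolyC.
  apply: leq_trans (mmeasureD_le _ _ _) _; rewrite geq_max; apply/andP; split.
    have [->|q0] := eqVneq (mshift a 'X_[m'] - 'X_[m']) 0.
      by rewrite mulr0 mmeasure0.
    have X0 : 'X_i != 0 :> P by rewrite -(mmeasure_poly_eq0 mdeg) msizeX.
    by rewrite msizeM // msizeX mdeg1; exact: (IH _ dm').
  apply: leq_trans (msizeZ_le _ _) _.
  rewrite -[mshift a _](subrK 'X_[m']).
  apply: leq_trans (mmeasureD_le _ _ _) _; rewrite geq_max msizeX dm' leqnn andbT.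
  exact: leq_trans (IH _ dm') _.
case E: (msize p) => [//|k] _; rewrite ltnS.
rewrite {1 2}(mpolyE p) /mshift raddf_sum -sumrB.
apply: leq_trans (mmeasure_sum _ _ _ _) _; rewrite big_seq.
elim/big_ind: _ => // [x y hx hy|m mp]; first by rewrite geq_max hx.
rewrite /= comp_mpolyZ -scalerBr; apply: leq_trans (msizeZ_le _ _) _.
apply: leq_trans (mono _ _ erefl) _.
by have := msize_mdeg_lt mp; rewrite E ltnS.
Qed.

Lemma mderiv_eq0 p : (forall i, p^`M(i) = 0) -> (msize p <= 1)%N.
Proof.
move=> dp; suff -> : p = (p@_0)%:MP by rewrite mmeasureC leq_b1.
apply/mpolyP => m; rewrite mcoeffC; have [->|m0] := eqVneq m 0%MM.
  by rewrite mulr1.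
have [i [m' ->]] := mnm_predU m0; rewrite mulr0.
have := mcoeff_deriv i m' p; rewrite dp mcoeff0 addmC => /esym/eqP.
by rewrite mulrn_eq0 /= => /eqP.
Qed.

(** Partial derivatives inherit the invariance, so by induction they are constants and [p] is
    affine. Its linear part is orthogonal to every [a i], hence 0. *)
Lemma mshift_invariant_const k (a : 'I_k -> 'I_r -> F) :
    (forall x : 'I_r -> F, (forall i, \sum_j a i j * x j = 0) -> forall j, x j = 0) ->
  forall p, (forall i, mshift (a i) p = p) -> (msize p <= 1)%N.
Proof.
move=> span p; move ds: (msize p) => s; elim/ltn_ind: s p ds => s IH p ds inv.
have [p0|p0] := eqVneq p 0; first by rewrite -ds p0 mmeasure0.
have dC j : exists c, p^`M(j) = c%:MP.
  exists (p^`M(j)@_0); apply: msize1_polyC.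
  apply: (IH _ _ _ erefl); first by rewrite -ds msize_mderiv.
  by move=> i; rewrite -mshift_deriv inv.
have [c cP] := choice dC.
pose l : P := \sum_j (c j)%:MP * 'X_j.
have lE i : l^`M(i) = (c i)%:MP.
  rewrite /l raddf_sum (bigD1 i) //= mderiv_mulC mderivXU eqxx mulr1 big1 ?addr0 //.
  by move=> j ji; rewrite mderiv_mulC mderivXU eq_sym (negPf ji) mpolyC0 mulr0.
have /msize1_polyC pE : (msize (p - l) <= 1)%N.
  by apply: mderiv_eq0 => i; rewrite mderivB cP lE subrr.
have c0 : forall j, c j = 0.
  apply: span => i; have := inv i; rewrite -[p](subrK l) pE mshiftD mshiftC.
  move/addrI/eqP; rewrite -subr_eq0 /l /mshift raddf_sum -sumrB /=.
  rewrite (eq_bigr (fun j => - (a i j * c j)%:MP)); last first.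
    move=> j _; rewrite -/(mshift (a i) _) mshiftM mshiftC mshiftX mulrBr addrAC subrr add0r.
    by rewrite -mpolyCM mulrC.
  by rewrite sumrN oppr_eq0 -raddf_sum /= mpolyC_eq0 => /eqP.
have l0 : l = 0 by rewrite /l big1 // => j _; rewrite c0 mpolyC0 mul0r.
by rewrite -ds -[p](subrK l) pE l0 addr0 mmeasureC leq_b1.
Qed.
End Shift.

(** * Torsion over U(h) *)

Section EnvelopingInduction.
Import finmap monalg.
Variables (K : fieldType) (L : lieAlgType K).
Local Notation mkm s := (fmonom_of_seq fmonom_key s).

Lemma uenv_ind (Q : uenv L -> Prop) : (forall c : K, Q c%:A) ->
    (forall u v, Q u -> Q v -> Q (u + v)) ->
    (forall x u, Q u -> Q (uiota x * u)) ->
  forall u, Q u.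
Proof.
move=> QC QD QM u; rewrite -[u]ureprK; move: (urepr u) => f; rewrite (monalgE f).
elim: (enum_fset _) => [|w s IH].
  by rewrite big_nil -[0](scale0r 1) upiZ; apply: QC.
rewrite big_cons upiD; apply: QD => //; move: (mcoeff w f) => c {IH s f}.
have -> : w = mkm (fmonom_val w) by rewrite fmE fmK.
elim: (fmonom_val w) => [|x s IH].
  have -> : << c *g mkm [::] >> = c *: (1 : {malg K[{fmonom L}]}).
    by rewrite -mul_malgC mulr1.
  by rewrite upiZ; apply: QC.
have -> : << c *g mkm (x :: s) >> = fgen x * << c *g mkm s >>.
  rewrite malgM_def fgmulUU mul1r; congr << c *g _ >>.
  by rewrite -[RHS]/(fmmul (fmu x) (mkm s)) fmmulE fmuE !fmE.
rewrite upiM; exact: QM.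
Qed.

End EnvelopingInduction.

Section CartanPolynomials.
Variables (K : fieldType) (L : lieAlgType K) (M : lieModType L).
Variables (r : nat) (b : 'I_r -> L).

(** Evaluation at the [b i]. The type [uenv L] carries no commutative ring structure, so for abelian
    [L] only multiplication by one variable is transported, in [uevX]; with linearity this
    determines the action. *)
Definition uev (p : {mpoly K[r]}) : uenv L :=
  mmap (in_alg (uenv L)) (fun i => uiota (b i)) p.

Lemma uevD p q : uev (p + q) = uev p + uev q.
Proof. exact: mmapD. Qed.

Lemma uevZ c p : uev (c *: p) = c *: uev p.
Proof. by rewrite /uev mmapZ mulr_algl. Qed.

Lemma uevC c : uev c%:MP = c%:A.
Proof. exact: mmapC. Qed.

Lemma uactZ (c : K) (u : uenv L) (m : M) : uact (c *: u) m = c *: uact u m.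
Proof.
rewrite -[u]ureprK -[c *: _]upiZ !uactE.
by have := free_act_linearl m c (urepr u) 0; rewrite /= addr0 free_act0l addr0.
Qed.

Lemma uact0l (m : M) : uact (0 : uenv L) m = 0.
Proof. by rewrite -(scale0r (0 : uenv L)) uactZ scale0r. Qed.

Lemma uact_linearr (u : uenv L) : linear (uact u : M -> M).
Proof. exact: free_act_linearr. Qed.

Lemma uiota0 : uiota (0 : L) = 0.
Proof.
have := uiota_linear (0 : K) (0 : L) 0; rewrite !scale0r !add0r.
by have := uiota_linear (-1 : K) (0 : L) 0; rewrite !scaleN1r addNr => ->; rewrite addNr.
Qed.


Lemma uiota_sum (I : Type) (s : seq I) (f : I -> L) :
  uiota (\sum_(i <- s) f i) = \sum_(i <- s) uiota (f i).
Proof.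
elim: s => [|i s IH]; first by rewrite !big_nil uiota0.
by rewrite !big_cons -IH -[f i]scale1r uiota_linear !scale1r.
Qed.

Lemma uiotaZ (a : K) (x : L) : uiota (a *: x) = a *: uiota x.
Proof. by have := uiota_linear a x 0; rewrite uiota0 !addr0. Qed.

Hypothesis L_abelian : forall x y : L, bracket x y = 0.
Hypothesis b_span : forall x : L, exists c : 'I_r -> K, x = \sum_i c i *: b i.

Lemma uiota_comm (x y : L) : uiota x * uiota y = uiota y * uiota x.
Proof. by apply/subr0_eq; rewrite -uiota_bracket L_abelian uiota0. Qed.

Lemma uiota_central x (u : uenv L) : u * uiota x = uiota x * u.
Proof.
elim/uenv_ind: u => [c|u v hu hv|y u hu]; first by rewrite mulr_algl mulr_algr.
  by rewrite mulrDl mulrDr hu hv.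
by apply/esym/commrM; [exact: uiota_comm|exact: esym].
Qed.

Lemma uevX i p : uev ('X_i * p) = uiota (b i) * uev p.
Proof.
elim/mpolyind: p => [|c m p _ _ IH].
  by rewrite mulr0 -mpolyC0 uevC scale0r mulr0.
rewrite mulrDr !uevD IH mulrDr; congr (_ + _).
rewrite -scalerAr -mpolyXD /uev !mmapZ !mmapX commr_mmap1_M; last first.
  by move=> j y; apply: uiota_central.
rewrite mmap1U !mulr_algl; exact: uscaleAr.
Qed.

Lemma uev_surj (u : uenv L) : exists p, u = uev p.
Proof.
elim/uenv_ind: u => [c|u v [p ->] [q ->]|x u [p ->]].
- by exists c%:MP; rewrite uevC.
- by exists (p + q); rewrite uevD.
have [c ->] := b_span x; exists (\sum_i c i *: ('X_i * p)).
have uevs (s : seq 'I_r) (f : 'I_r -> {mpoly K[r]}) :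
    uev (\sum_(i <- s) f i) = \sum_(i <- s) uev (f i).
  by rewrite /uev raddf_sum.
rewrite uiota_sum mulr_suml uevs; apply: eq_bigr => i _ /=.
by rewrite uevZ uevX uiotaZ scalerAl.
Qed.
End CartanPolynomials.

(** * Nilpotent action and root vectors *)

Section LieModuleTheory.
Variables (K : fieldType) (L : lieAlgType K) (M : lieModType L).
Implicit Types (x y : L) (m : M).

HB.instance Definition _ x :=
  GRing.isLinear.Build K M M *:%R (lact x) (lact_linearr (s := M) x).

Lemma lactDl x y m : lact (x + y) m = lact x m + lact y m.
Proof. by have := lact_linearl m 1 x y; rewrite /= !scale1r. Qed.

Lemma lact0l m : lact (0 : L) m = 0.
Proof. by apply: (addrI (lact 0 m)); rewrite -lactDl !addr0. Qed.

Lemma lactZl a x m : lact (a *: x) m = a *: lact x m.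
Proof. by have := lact_linearl m a x 0; rewrite /= lact0l !addr0. Qed.

Lemma lact_suml I (r : seq I) (f : I -> L) m :
  lact (\sum_(i <- r) f i) m = \sum_(i <- r) lact (f i) m.
Proof. exact: (big_morph _ (fun x y => lactDl x y m) (lact0l m)). Qed.

Lemma lact_swap x y m : lact x (lact y m) = lact (bracket x y) m + lact y (lact x m).
Proof. by rewrite lact_bracket subrK. Qed.

Lemma iter_lact_linear k x : linear (iter k (lact x) : M -> M).
Proof. by elim: k => // k IH a u v; rewrite !iterS IH linearP. Qed.

Lemma iter_lact0 k x : iter k (lact x) 0 = 0 :> M.
Proof. by elim: k => // k IH; rewrite iterS IH linear0. Qed.

Lemma iter_lact_ge j k x m : (j <= k)%N -> iter j (lact x) m = 0 -> iter k (lact x) m = 0.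
Proof.
by move=> jk mj; rewrite -(subnK jk) iterD mj iter_lact0.
Qed.

(** Moving one [e] past [y] gives a term with [e, y] and a term with e m, and each lowers one of the
    two exponents. *)
Lemma nilp_leibniz e y i j m :
  iter i (bracket e) y = 0 -> iter j (lact e) m = 0 ->
  iter (i + j) (lact e) (lact y m) = 0.
Proof.
move eqk: (i + j)%N => k; elim: k i j y m eqk => [|k IH] i j y m eqk yi mj.
  case: i j eqk yi mj => [|//] [|//] _ /= -> ->; exact: lact0l.
case: i eqk yi => [|i] eqk yi.
  by rewrite [y]yi lact0l iter_lact0.
case: j eqk mj => [|j] eqk mj.
  by rewrite [m]mj linear0 iter_lact0.
rewrite iterSr lact_swap -[lact (bracket _ _) _]scale1r iter_lact_linear scale1r.
have -> : iter k (lact e) (lact (bracket e y) m) = 0.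
  by apply: (IH i j.+1) => //; [move: eqk; rewrite addSn => -[]|rewrite -iterSr].
rewrite add0r; apply: (IH i.+1 j) => //; last by rewrite -iterSr.
by move: eqk; rewrite addnS => -[].
Qed.

Lemma nilp_submodule e : (forall y, exists N, iter N (bracket e) y = 0) ->
  lie_submodule (fun m : M => exists k, iter k (lact e) m = 0).
Proof.
move=> ade; split.
- by exists 0.
- move=> a u v [j uj] [k vk]; exists (j + k)%N.
  rewrite iter_lact_linear (iter_lact_ge (leq_addr k j) uj).
  by rewrite (iter_lact_ge (leq_addl j k) vk) scaler0 addr0.
- move=> y u [j uj]; have [i yi] := ade y; exists (i + j)%N.
  exact: nilp_leibniz.
Qed.
End LieModuleTheory.

(** Applying T minus the first eigenvalue drops the first summand, rescales the others and
    multiplies [w] by a nonzero scalar. *)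
Lemma eigenvector_sum_eq0 (K : fieldType) (V : lmodType K) (T : {linear V -> V})
    (I : eqType) (s : seq I) (f : I -> V) (c : I -> K) (b : K) w :
  (forall i, i \in s -> T (f i) = c i *: f i) -> T w = b *: w ->
  w = \sum_(i <- s) f i -> (forall i, i \in s -> c i != b) -> w = 0.
Proof.
elim: s f w => [|i s IH] f w fT wT wE cb; first by rewrite wE big_nil.
have cib : b - c i != 0 by rewrite subr_eq0 eq_sym cb ?mem_head.
apply: (scalerI cib); rewrite scaler0.
apply: (IH (fun j => (c j - c i) *: f j)).
- by move=> j js; rewrite linearZ /= fT ?inE ?js ?orbT // !scalerA mulrC.
- by rewrite linearZ /= wT !scalerA mulrC.
- rewrite scalerBl -wT wE big_cons linearD linear_sum /= fT ?mem_head //.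
  rewrite scalerDr opprD addrACA subrr add0r scaler_sumr -sumrB.
  apply: eq_big_seq => j js; rewrite fT ?inE ?js ?orbT //.
  by rewrite scalerBl.
- by move=> j js; rewrite cb // inE js orbT.
Qed.

Section RootVectors.
Variables (F : numClosedFieldType) (g : finLieAlgType F) (h : lieSubalg g).
Variables (k : nat) (pr : 'I_k -> g -> g) (al : 'I_k -> g -> F).
Hypotheses (pr_sum : forall u, \sum_i pr i u = u)
  (pr_wt : forall i u, weight_vector h (al i) (pr i u)).
Local Notation hh := (h : {vspace g}).

Lemma weight_vector_iter be de e w n : weight_vector h de e -> weight_vector h be w ->
  weight_vector h (fun x => be x + de x *+ n) (iter n (bracket e) w).
Proof.
move=> we ww; elim: n => [|n IH] x xh /=; first by rewrite ww // addr0.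
rewrite bracket_derivation (we _ xh) (IH _ xh) bracketZl linearZ /= -scalerDl.
by rewrite mulrS addrCA.
Qed.

(** Iterating [ad e] on a component of weight [al i] produces at [x] the eigenvalues al i x + n de
    x, distinct in characteristic zero. Among [k.+1] of them one is not a value of the [k] weights,
    and that iterate is 0. *)
Lemma root_vector_ad_nilp de e x : weight_vector h de e -> x \in hh -> de x != 0 ->
  forall y, exists N, iter N (bracket e) y = 0.
Proof.
move=> we xh dx y; have e_it N := iter_bracket0 N e.
have it_lin N : linear (iter N (bracket e)).
  by elim: N => // N IH a u v; rewrite !iterS IH linearP.
have it_ge i j z : (i <= j)%N -> iter i (bracket e) z = 0 -> iter j (bracket e) z = 0.
  by move=> ij zi; rewrite -(subnK ij) iterD zi e_it.
have key i : exists N, iter N (bracket e) (pr i y) = 0.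
  pose vals := [seq al l x | l <- enum 'I_k].
  have sv : size vals = k by rewrite size_map -cardE card_ord.
  have [n /mapP nN] : exists n, al i x + de x *+ n \notin vals.
    apply: contrapT => all_in.
    have sub : {subset [seq al i x + de x *+ n | n <- iota 0 k.+1] <= vals}.
      move=> _ /mapP[n _ ->]; apply/negPn/negP => nin; apply: all_in.
      by exists n.
    have un : uniq [seq al i x + de x *+ n | n <- iota 0 k.+1].
      rewrite map_inj_uniq ?iota_uniq // => n1 n2 /addrI /eqP.
      by rewrite -!(mulr_natr (de x)) (inj_eq (mulfI dx)) eqr_nat => /eqP.
    have := uniq_leq_size un sub.
    by rewrite size_map size_iota sv ltnn.
  exists n; set w := iter _ _ _.
  apply: (@eigenvector_sum_eq0 _ g (bracket x) 'I_k (enum 'I_k) (fun l => pr l w)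
    (fun l => al l x) (al i x + de x *+ n)).
  - by move=> l _; apply: pr_wt.
  - by apply: weight_vector_iter => // z zh; apply: pr_wt.
  - by rewrite big_enum /= pr_sum.
  - by move=> l _; apply/eqP => alE; apply: nN; exists l; rewrite ?mem_enum.
have [N NP] := choice key; exists (\max_i N i); rewrite -(pr_sum y).
have it0 n : iter n (bracket e) 0 = 0 by exact: iter_bracket0.
have it_sum n : iter n (bracket e) (\sum_i pr i y) = \sum_i iter n (bracket e) (pr i y).
  elim/big_rec2: _ => [|l u v _ <-]; first exact: it0.
  by rewrite -[pr l y]scale1r it_lin !scale1r.
rewrite it_sum.
by apply: big1 => l _; apply: it_ge (NP l); apply: leq_bigmax.
Qed.
End RootVectors.

(** * Polynomials annihilating a torsion module *)

Section TorsionModule.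
Variables (F : numClosedFieldType) (g : finLieAlgType F) (h : lieSubalg g).
Variables (M : lieModType g) (r : nat) (b : 'I_r -> g).
Local Notation hh := (h : {vspace g}).
Local Notation P := {mpoly F[r]}.
Variable pact : P -> M -> M.
Hypotheses (b_h : forall i, b i \in hh)
  (b_free : forall x : 'I_r -> F, \sum_j x j *: b j = 0 -> forall j, x j = 0)
  (pactD : forall p q m, pact (p + q) m = pact p m + pact q m)
  (pactC : forall c m, pact c%:MP m = c *: m)
  (pactX : forall i p m, pact ('X_i * p) m = lact (b i) (pact p m))
  (pact_lin : forall p, linear (pact p)).
Hypotheses (g_simple : simple_lie g) (M_simple : simple_lie_module M).
Variables (k : nat) (pr : 'I_k -> g -> g) (al : 'I_k -> g -> F).
Hypotheses (pr_sum : forall u, \sum_i pr i u = u)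
  (pr_wt : forall i u, weight_vector h (al i) (pr i u)).
Implicit Types (p q : P) (m : M).

Lemma pact0r p : pact p 0 = 0.
Proof. by have := pact_lin p (-1) 0 0; rewrite scaler0 addr0 scaleN1r addNr. Qed.

Lemma pactM p q m : pact (p * q) m = pact p (pact q m).
Proof.
elim/mpoly_alg_ind: p => [c|p1 p2 h1 h2|i p IH].
- rewrite pactC; elim/mpoly_alg_ind: q => [d|q1 q2 h1 h2|i q IH].
  + by rewrite -mpolyCM !pactC scalerA.
  + by rewrite mulrDr !pactD h1 h2 scalerDr.
  + by rewrite mulrCA !pactX IH linearZ.
- by rewrite mulrDl !pactD h1 h2.
- by rewrite -mulrA !pactX IH.
Qed.

Lemma pactB p q m : pact (p - q) m = pact p m - pact q m.
Proof. by apply/eqP; rewrite eq_sym subr_eq -pactD subrK. Qed.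

Lemma pact_shift (be : g -> F) e p m : weight_vector h be e ->
  lact e (pact p m) = pact (mshift (fun i => be (b i)) p) (lact e m).
Proof.
move=> we; elim/mpoly_alg_ind: p => [c|p q hp hq|i p IH].
- by rewrite mshiftC !pactC linearZ.
- by rewrite mshiftD !pactD linearD /= hp hq.
- rewrite mshiftM mshiftX pactX mulrBl pactB pactX pactM pactC -IH lact_swap.
  by rewrite bracketC we // -scaleNr lactZl scaleNr addrC.
Qed.

Lemma pact_iter_shift (be : g -> F) e p m n : weight_vector h be e ->
  iter n (lact e) (pact p m) =
  pact (iter n (mshift (fun i => be (b i))) p) (iter n (lact e) m).
Proof. by move=> we; elim: n => //= n ->; apply: pact_shift. Qed.

Lemma torsion_submodule : lie_submodule (fun m => exists2 p, p != 0 & pact p m = 0).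
Proof.
have closedD c u v : (exists2 p, p != 0 & pact p u = 0) ->
    (exists2 p, p != 0 & pact p v = 0) -> exists2 p, p != 0 & pact p (c *: u + v) = 0.
  move=> [p p0 pu] [q q0 qv]; exists (p * q); first by rewrite mulf_neq0.
  by rewrite pact_lin mulrC pactM pu pact0r scaler0 add0r mulrC pactM qv pact0r.
have zero : exists2 p, p != 0 & pact p 0 = 0.
  by exists 1; [exact: oner_neq0|exact: pact0r].
split=> // x u Tu; rewrite -(pr_sum x) lact_suml.
elim/big_rec: _ => // i w _ Tw; rewrite -[lact _ _]scale1r; apply: closedD => //.
have [p p0 pu] := Tu; exists (mshift (fun j => al i (b j)) p); first by rewrite mshift_eq0.
rewrite -(pact_shift (be := al i)) ?pu ?linear0 //; exact: pr_wt.
Qed.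

Hypothesis M_fg : exists s : seq M, forall m, exists c : nat -> P,
  m = \sum_(i < size s) pact (c i) s`_i.

Lemma uniform_annihilator p0 m0 : p0 != 0 -> m0 != 0 -> pact p0 m0 = 0 ->
  exists2 p, p != 0 & forall m, pact p m = 0.
Proof.
move=> p0_0 m0_0 pm0.
have T m : exists2 p, p != 0 & pact p m = 0.
  have [T0|//] := M_simple.2 _ torsion_submodule.
  by rewrite (T0 m0) ?eqxx // in m0_0; exists p0.
have [s s_gen] := M_fg.
have [p pn0 ps] : exists2 p, p != 0 & forall m, m \in s -> pact p m = 0.
  elim: s {s_gen} => [|m s [p pn0 ps]]; first by exists 1; first exact: oner_neq0.
  have [q q0 qm] := T m; exists (p * q); first by rewrite mulf_neq0.
  move=> u; rewrite inE => /orP[/eqP->|us]; first by rewrite pactM qm pact0r.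
  by rewrite mulrC pactM ps // pact0r.
exists p => // m; have [c ->] := s_gen m.
have psum : forall f : 'I_(size s) -> M, pact p (\sum_i f i) = \sum_i pact p (f i).
  move=> f; elim/big_rec2: _ => [|i u v _ <-]; first exact: pact0r.
  by rewrite -[f i]scale1r pact_lin !scale1r.
rewrite psum big1 // => i _; rewrite -pactM mulrC pactM ps ?pact0r //.
exact: mem_nth.
Qed.

Lemma minimal_annihilator : (exists2 p, p != 0 & forall m, pact p m = 0) ->
  exists p, [/\ p != 0, forall m, pact p m = 0 &
    forall q, q != 0 -> (msize q < msize p)%N -> exists m, pact q m != 0].
Proof.
move=> [p0 p00 p0M].
pose Q n := `[< exists p, [/\ p != 0, forall m, pact p m = 0 & msize p = n] >].
have exQ : exists n, Q n by exists (msize p0); apply/asboolP; exists p0.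
have [n /asboolP[p [pn0 pM <-]] nmin] := ex_minnP exQ.
exists p; split=> // q q0 qp; apply: contrapT => nex.
have /nmin : Q (msize q).
  apply/asboolP; exists q; split=> // m; apply/eqP/negPn/negP => qm.
  by apply: nex; exists m.
by rewrite leqNgt qp.
Qed.

(** The element of [h] with coordinates [x] is killed by all roots, so it is central, and a simple
    algebra has no centre. *)
Lemma roots_span (x : 'I_r -> F) : (forall i, \sum_j al i (b j) * x j = 0) ->
  forall j, x j = 0.
Proof.
move=> ax; apply: b_free; apply: (simple_centerless g_simple) => u.
rewrite -(pr_sum u) linear_sum; apply: big1 => i _ /=.
rewrite bracket_suml (eq_bigr (fun j => (al i (b j) * x j) *: pr i u)).
  by rewrite -scaler_suml ax scale0r.
by move=> j _; rewrite bracketZl (pr_wt i u (b_h j)) scalerA mulrC.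
Qed.

(** Otherwise [p] is a nonzero constant, which acts on the nonzero [M] by an invertible scalar. *)
Lemma moved_by_root p : p != 0 -> (forall m, pact p m = 0) ->
  exists i, mshift (fun j => al i (b j)) p != p.
Proof.
move=> p0 pM; apply: contrapT => nex.
have /msize1_polyC pE : (msize p <= 1)%N.
  apply: (mshift_invariant_const roots_span) => i.
  by apply/eqP/negPn/negP => ne; apply: nex; exists i.
move: (p@_0) pE p0 => c pE; rewrite pE mpolyC_eq0 => /negP[].
have [[m m0] _] := M_simple.
by have /eqP := pM m; rewrite pE pactC scaler_eq0 (negPf m0) orbF.
Qed.

(* The last nonzero iterated difference q of the minimal annihilator p along
   the root satisfies q e^j M = 0 and commutes with e, while qM <> 0. *)
Lemma root_vector_kills p (be : g -> F) e : p != 0 -> (forall m, pact p m = 0) ->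
    (forall q, q != 0 -> (msize q < msize p)%N -> exists m, pact q m != 0) ->
    mshift (fun j => be (b j)) p != p -> weight_vector h be e ->
  exists2 m : M, m != 0 & exists n, iter n (lact e) m = 0.
Proof.
move=> p0 pM pmin ps we; set sh := mshift _ in ps; pose D q := sh q - q.
have D0 : D 0 = 0 by rewrite /D /sh subr0; apply/eqP; rewrite mshift_eq0.
have Dsize q : (msize (D q) <= (msize q).-1)%N.
  have [->|q0] := eqVneq q 0; first by rewrite D0 mmeasure0.
  have := msize_mshift_sub (fun j => be (b j)) q0.
  by case: (msize q).
have itsize n : (msize (iter n D p) <= msize p - n)%N.
  elim: n => [|n IH]; first by rewrite subn0.
  rewrite iterS (leq_trans (Dsize _)) // subnS.
  by move: IH; case: (msize _) => // a; case: (_ - _)%N => // c; rewrite ltnS.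
have exn : exists n, iter n D p == 0.
  exists (msize p); rewrite -(mmeasure_poly_eq0 mdeg) -leqn0.
  by have := itsize (msize p); rewrite subnn.
(* The first vanishing difference has order at least 2, since [p] and its first difference are
   nonzero; so [q] is strictly smaller than [p]. *)
have [[|[|n]] /eqP nD nmin] := ex_minnP exn; first by case/negP: p0; apply/eqP.
  by case/negP: ps; rewrite -subr_eq0; apply/eqP.
set q := iter n.+1 D p.
have q0 : q != 0 by apply/negP => /nmin; rewrite ltnn.
have [|m qm] := pmin q q0.
  rewrite (leq_ltn_trans (itsize _)) // ltn_subrL /= lt0n mmeasure_poly_eq0 //.
have shq : sh q = q by apply/subr0_eq.
(* The next difference applied to e^(i+1) m' is [e] times the [i]-th one on e^i m', minus the [i]-th
   one on e^i (e m'); both vanish by induction. *)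
have kill i m' : pact (iter i D p) (iter i (lact e) m') = 0.
  elim: i m' => [|i IH] m'; first exact: pM.
  rewrite /= {1}/D pactB /sh -(pact_shift _ _ we) IH linear0 -iterS iterSr IH.
  by rewrite subr0.
exists (pact q m) => //; exists n.+1.
rewrite (pact_iter_shift _ _ _ we) -/sh.
have -> : iter n.+1 sh q = q by elim: n.+1 => //= i ->.
exact: kill.
Qed.

(** Powers of [e] pass through the polynomial coefficients at the price of a translation, so an
    exponent good for the generators is good everywhere. *)
Lemma uniform_nilpotent (be : g -> F) e : weight_vector h be e ->
    (forall m : M, exists n, iter n (lact e) m = 0) ->
  exists n, forall m : M, iter n (lact e) m = 0.
Proof.
move=> we nil; have [s s_gen] := M_fg.
have [n ns] : exists n, forall m, m \in s -> iter n (lact e) m = 0.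
  elim: s {s_gen} => [|m s [n ns]]; first by exists 0.
  have [j mj] := nil m; exists (n + j)%N => u; rewrite inE => /orP[/eqP->|us].
    exact: iter_lact_ge (leq_addl _ _) mj.
  exact: iter_lact_ge (leq_addr _ _) (ns u us).
exists n => m; have [c ->] := s_gen m.
have isum : forall f : 'I_(size s) -> M,
    iter n (lact e) (\sum_i f i) = \sum_i iter n (lact e) (f i).
  move=> f; elim/big_rec2: _ => [|i u v _ <-]; first exact: iter_lact0.
  by rewrite -[f i]scale1r iter_lact_linear !scale1r.
rewrite isum big1 // => i _; rewrite (pact_iter_shift _ _ _ we) ns ?pact0r //.
exact: mem_nth.
Qed.

Hypothesis pr_neq0 : forall i, exists u, pr i u != 0.

Lemma exists_nilpotent_root_vector p0 m0 : p0 != 0 -> m0 != 0 -> pact p0 m0 = 0 ->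
  exists e, [/\ e != 0, forall y, exists N, iter N (bracket e) y = 0 &
    exists n, forall m : M, iter n (lact e) m = 0].
Proof.
move=> p0_0 m0_0 pm0.
have [p [pn0 pM pmin]] := minimal_annihilator (uniform_annihilator p0_0 m0_0 pm0).
have [i pi] := moved_by_root pn0 pM; have [u e0] := pr_neq0 i.
have we := pr_wt i u; set e := pr i u in e0 we.
(* A root vanishing on [h] would translate trivially and could not move [p]; its nonvanishing gives
   ad-nilpotency of [e]. *)
have [x xh ax] : exists2 x, x \in hh & al i x != 0.
  apply: contrapT => nex; case/eqP: pi; elim/mpoly_alg_ind: (p) => [c|q1 q2 h1 h2|j q IH].
  - exact: mshiftC.
  - by rewrite mshiftD h1 h2.
  - rewrite mshiftM IH mshiftX (_ : al i (b j) = 0) ?mpolyC0 ?subr0 //.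
    by apply/eqP/negPn/negP => aj; apply: nex; exists (b j).
have ade := root_vector_ad_nilp pr_sum pr_wt we xh ax.
exists e; split=> //; apply: (uniform_nilpotent we) => m.
have [m1 m10 [n em1]] := root_vector_kills pn0 pM pmin pi we.
have [N0|] := M_simple.2 _ (nilp_submodule M ade); last exact.
by rewrite (N0 m1) ?eqxx // in m10; exists n.
Qed.
End TorsionModule.

(** * Nilpotent elements and finiteness *)

Section ExponentialOrbit.
Variables (F : numFieldType) (A : algType F).
Variables (J : A -> Prop) (y : A) (x : nat -> A) (l K : nat).
Hypotheses (J0 : J 0) (JD : forall u v, J u -> J v -> J (u + v))
  (JZ : forall (a : F) u, J u -> J (a *: u))
  (JMl : forall u v, J v -> J (u * v)) (JMr : forall u v, J u -> J (u * v)).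
Hypotheses (x_ad : forall j, y * x j - x j * y = x j.+1)
  (x_nilp : forall j, (l <= j)%N -> x j = 0) (xK : J (x 0%N ^+ K)).

(** The curve exp (t ad y) x as a polynomial in t, where [x j] is the [j]-th iterated commutator of
    [y] with [x 0]. *)
Definition exp_poly : {poly A} := \poly_(j < l) ((j`!%:R)^-1 *: x j).

Lemma coef_exp_poly j : exp_poly`_j = (j`!%:R)^-1 *: x j.
Proof. by rewrite coef_poly; case: ltnP => // /x_nilp ->; rewrite scaler0. Qed.

Lemma exp_poly_deriv : exp_poly^`() = y%:P * exp_poly - exp_poly * y%:P.
Proof.
apply/polyP => j; rewrite coef_deriv coefB coefCM coefMC !coef_exp_poly.
rewrite -scalerAr -scalerAl -scalerBr x_ad scalerMnl; congr (_ *: _).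
rewrite factS natrM invfM -mulr_natl mulrA mulfV ?mul1r //.
by rewrite pnatr_eq0.
Qed.

(* Z = exp_poly ^+ K solves Z' = [y, Z], so all its coefficients lie in the
   ideal J as soon as the constant one does. *)
Lemma coef_exp_polyX j : J ((exp_poly ^+ K)`_j).
Proof.
have deriv n : (exp_poly ^+ n)^`() = y%:P * exp_poly ^+ n - exp_poly ^+ n * y%:P.
  elim: n => [|n IH]; first by rewrite !expr0 mulr1 mul1r subrr derivC.
  rewrite exprS derivM IH exp_poly_deriv mulrBl mulrBr !mulrA.
  by rewrite addrA subrK.
elim: j => [|j IH].
  have -> : (exp_poly ^+ K)`_0 = x 0%N ^+ K.
    elim: (K) => [|n IH]; first by rewrite !expr0 coef1.
    by rewrite !exprS coef0M IH coef_exp_poly fact0 invr1 scale1r.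
  exact: xK.
have := congr1 (fun q : {poly A} => q`_j) (deriv K).
rewrite coef_deriv coefB coefCM coefMC -scaler_nat => /(congr1 (fun u => (j.+1%:R)^-1 *: u)).
rewrite scalerA mulVf ?pnatr_eq0 // scale1r => ->; apply: JZ; apply: JD; first exact: JMl.
by rewrite -scaleN1r; apply: JZ; apply: JMr.
Qed.

(** Evaluation at t is multiplicative because scalars are central in [A], so the power may be taken
    before evaluating. *)
Lemma exp_orbit_pow (t : F) : J ((\sum_(j < l) (t ^+ j / j`!%:R) *: x j) ^+ K).
Proof.
have -> : \sum_(j < l) (t ^+ j / j`!%:R) *: x j = exp_poly.[t%:A].
  rewrite horner_poly; apply: eq_bigr => j _.
  by rewrite exprZn expr1n mulr_algr scalerA.
have cm n : comm_poly (exp_poly ^+ n) t%:A.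
  by rewrite /comm_poly mulr_algl mulr_algr.
have -> : exp_poly.[t%:A] ^+ K = (exp_poly ^+ K).[t%:A].
  elim: (K) => [|n IH]; first by rewrite !expr0 hornerC.
  by rewrite exprSr IH -hornerM_comm -?exprSr //; exact: (cm 1%N).
rewrite horner_coef; elim/big_ind: _ => // j _; apply: JMr.
exact: coef_exp_polyX.
Qed.
End ExponentialOrbit.

(** Modulo [U] each coordinate of the curve is a polynomial in t with more roots than its degree
    allows, namely natural numbers, so all its coefficients vanish. *)
Lemma memv_poly_curve (F : numFieldType) (V : vectType F) (U : {vspace V})
    (w : nat -> V) l : (forall t : F, \sum_(j < l) t ^+ j *: w j \in U) ->
  forall j, (j < l)%N -> w j \in U.
Proof.
move=> curve j jl; pose pi v := v - projv U v.
have pi_lin : linear pi.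
  by move=> a u v; rewrite /pi linearP opprD addrACA scalerBr.
pose piL : {linear V -> V} := HB.pack pi (GRing.isLinear.Build F V V *:%R pi pi_lin).
have piU v : (v \in U) = (pi v == 0).
  rewrite subr_eq0; apply/idP/eqP => [/projv_id -> //|->]; exact: memv_proj.
rewrite piU; set e := vbasis (fullv : {vspace V}).
rewrite [pi _](coord_vbasis (memvf _)) big1 // => i _.
pose q := \poly_(m < l) coord e i (pi (w m)).
suff -> : coord e i (pi (w j)) = 0 by rewrite scale0r.
have -> : coord e i (pi (w j)) = q`_j by rewrite coef_poly jl.
suff -> : q = 0 by rewrite coef0.
have roots t : q.[t] = 0.
  have : coord e i (pi (\sum_(j < l) t ^+ j *: w j)) = 0.
    by have := curve t; rewrite piU => /eqP ->; rewrite linear0.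
  rewrite -[pi _]/(piL _) !linear_sum horner_poly => curve0.
  by rewrite -[RHS]curve0; apply: eq_bigr => m _; rewrite !linearZ /= mulrC.
apply: (@roots_geq_poly_eq0 _ _ [seq n%:R | n <- iota 0 (size q)]).
- by apply/allP => _ /mapP[n _ ->]; apply/eqP/roots.
- by rewrite map_inj_uniq ?iota_uniq // => m n /eqP; rewrite eqr_nat => /eqP.
- by rewrite size_map size_iota.
Qed.

Section NilpotentSpan.
Variables (F : numClosedFieldType) (g : finLieAlgType F) (M : lieModType g).

Definition nilpotent_on (x : g) := exists K, forall m : M, iter K (lact x) m = 0.

Lemma uactX (x : g) n (m : M) : uact (uiota x ^+ n) m = iter n (lact x) m.
Proof.
elim: n => [|n IH]; first by rewrite expr0 uact1.
by rewrite exprS -uactA uact_iota IH.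
Qed.

(** The ideal [J] of [exp_orbit_pow] is taken to be the annihilator of [M] in the enveloping algebra
    of g. *)
Lemma exp_nilpotent_on (x y : g) l : nilpotent_on x -> iter l (bracket y) x = 0 ->
  forall t : F, nilpotent_on (\sum_(j < l) (t ^+ j / j`!%:R) *: iter j (bracket y) x).
Proof.
move=> [K xK] yl t; exists K => m; rewrite -uactX.
pose J (u : uenv g) := forall m : M, uact u m = 0.
suff : J (uiota (\sum_(j < l) (t ^+ j / j`!%:R) *: iter j (bracket y) x) ^+ K) by [].
have -> : uiota (\sum_(j < l) (t ^+ j / j`!%:R) *: iter j (bracket y) x) =
   \sum_(j < l) (t ^+ j / j`!%:R) *: uiota (iter j (bracket y) x).
  by rewrite uiota_sum; apply: eq_bigr => j _; rewrite uiotaZ.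
apply: (exp_orbit_pow (J := J) (y := uiota y) (x := fun j => uiota (iter j (bracket y) x))).
- by move=> m'; rewrite uact0l.
- by move=> u v hu hv m'; rewrite uactDl hu hv addr0.
- by move=> a u hu m'; rewrite uactZ hu scaler0.
- by move=> u v hv m'; rewrite -uactA hv; apply: free_act0r.
- by move=> u v hu m'; rewrite -uactA hu.
- by move=> j; rewrite -uiota_bracket.
- by move=> j lj; rewrite -(subnK lj) iterD yl iter_bracket0 uiota0.
- by move=> m'; rewrite uactX.
Qed.
End NilpotentSpan.

Section NilpotentGenerators.
Variables (F : numClosedFieldType) (g : finLieAlgType F) (h : lieSubalg g)
  (M : lieModType g).
Variables (k : nat) (pr : 'I_k -> g -> g) (al : 'I_k -> g -> F).
Hypotheses (g_simple : simple_lie g) (h_norm : self_normalizing h).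
Hypotheses (pr_sum : forall u, \sum_i pr i u = u)
  (pr_wt : forall i u, weight_vector h (al i) (pr i u)).

(* The span U of the elements nilpotent on M is stable under exp (t ad y), hence
   under ad y, for y ad-nilpotent; the stabiliser of U is an ideal. *)
Lemma nilpotent_span e : e != 0 -> (forall y, exists N, iter N (bracket e) y = 0) ->
    nilpotent_on M e ->
  exists s : seq g, (forall x, x \in s -> nilpotent_on M x) /\ <<s>>%VS = fullv.
Proof.
move=> e0 ade eM.
pose Sp z := exists s : seq g, (forall x, x \in s -> nilpotent_on M x) /\ z \in <<s>>%VS.
have cat_sub (s1 s2 : seq g) z :
    z \in <<s1>>%VS \/ z \in <<s2>>%VS -> z \in <<s1 ++ s2>>%VS.
  by rewrite span_cat => -[zs|zs]; [apply: (subvP (addvSl _ _))|apply: (subvP (addvSr _ _))].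
have cat_nil (s1 s2 : seq g) : (forall x, x \in s1 -> nilpotent_on M x) ->
    (forall x, x \in s2 -> nilpotent_on M x) -> forall x, x \in s1 ++ s2 -> nilpotent_on M x.
  by move=> h1 h2 x; rewrite mem_cat => /orP[/h1|/h2].
have [||U UE] := vspace_of_pred (Q := Sp).
- by exists [::]; split=> //; rewrite mem0v.
- move=> a u v [s1 [n1 u1]] [s2 [n2 v2]]; exists (s1 ++ s2); split; first exact: cat_nil.
  by rewrite rpredD ?rpredZ //; apply: (cat_sub); [left|right].
have nilU x : nilpotent_on M x -> x \in U.
  move=> xM; apply/UE; exists [:: x]; split; last by rewrite memv_span ?mem_head.
  by move=> z; rewrite inE => /eqP ->.
have stabU y : (forall x, nilpotent_on M x -> bracket y x \in U) ->
    forall x, x \in U -> bracket y x \in U.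
  move=> yU x /UE[s [ns xs]]; rewrite (coord_span (X := in_tuple s) xs).
  rewrite linear_sum; apply: rpred_sum => i _; rewrite linearZ rpredZ //.
  by apply/yU/ns; rewrite mem_nth.
have root_stab y : (forall z, exists N, iter N (bracket y) z = 0) ->
    forall x, x \in U -> bracket y x \in U.
  move=> ady; apply: (stabU y) => x xM; have [l yl] := ady x.
  (* The coefficient at index 1 is the bracket of [y] and [x]. With [l + 2] terms this index exists
     even for [l] equal to 0, and the added terms vanish. *)
  have := @memv_poly_curve F g U (fun j => (j`!%:R)^-1 *: iter j (bracket y) x) (l + 2) _ 1%N.
  rewrite addn2 (_ : 1`! = 1%N) // invr1 scale1r; apply=> // t.
  rewrite (eq_bigr (fun j : 'I_l.+2 => (t ^+ j / j`!%:R) *: iter j (bracket y) x)).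
    by apply/nilU/exp_nilpotent_on => //; rewrite !iterS yl !linear0.
  by move=> j _; rewrite scalerA.
pose St y := forall x, x \in U -> bracket y x \in U.
have St0 : St 0 by move=> x _; rewrite bracket0l mem0v.
have Stl a u v : St u -> St v -> St (a *: u + v).
  by move=> hu hv x xU; rewrite bracketDl bracketZl rpredD ?rpredZ ?hu ?hv.
have Stb u v : St u -> St v -> St (bracket u v).
  move=> hu hv x xU; have -> : bracket (bracket u v) x =
      bracket u (bracket v x) - bracket v (bracket u x).
    by rewrite [bracket u (bracket v x)]bracket_derivation addrK.
  by rewrite rpredB ?hu ?hv // ?hu ?hv.
have St_root i u : (exists2 x, x \in (h : {vspace g}) & al i x != 0) -> St (pr i u).
  move=> [x xh ax]; apply: root_stab.
  exact: (root_vector_ad_nilp pr_sum pr_wt (pr_wt i u) xh ax).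
have St_sum (I : Type) (s : seq I) (f : I -> g) : (forall i, St (f i)) ->
    St (\sum_(i <- s) f i).
  move=> Sf; elim/big_ind: _ => // u v hu hv.
  by rewrite -[u]scale1r; apply: Stl.
have [|||St_0|StT] := simple_ideal_trichotomy (Q := St) g_simple => //.
(* [St] is a subalgebra containing all root vectors of nonzero weight. A zero-weight component of
   [x] lies in [h]: it kills or rescales each component of [y], and those it does not kill are such
   root vectors. *)
- move=> x y Sy; rewrite -(pr_sum x) bracket_suml; apply: (St_sum) => i.
  have [ai|nai] := pselect (exists2 x, x \in (h : {vspace g}) & al i x != 0).
    exact: Stb (St_root i x ai) Sy.
  have zi : pr i x \in (h : {vspace g}).
    apply: h_norm => z zh; rewrite bracketC rpredN pr_wt //.
    suff -> : al i z = 0 by rewrite scale0r mem0v.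
    by apply/eqP/negPn/negP => az; apply: nai; exists z.
  rewrite -(pr_sum y) linear_sum; apply: (St_sum) => j /=; rewrite pr_wt //.
  have [->|aj] := eqVneq (al j (pr i x)) 0; first by rewrite scale0r.
  rewrite -[_ *: _]addr0; apply: Stl => //; apply: St_root.
  by exists (pr i x).
- by case/eqP: e0; apply: St_0; apply: (root_stab).
have [|||U0|UT] := simple_ideal_trichotomy (Q := fun x => x \in U) g_simple => //.
- exact: mem0v.
- by move=> a u v hu hv; rewrite rpredD ?rpredZ.
- by case/eqP: e0; apply: U0; apply: (nilU).
have allSp z : Sp z by apply/UE/UT.
suff [s [ns bs]] : exists s : seq g, (forall x, x \in s -> nilpotent_on M x) /\
    forall z, z \in (vbasis (fullv : {vspace g}) : seq g) -> z \in <<s>>%VS.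
  exists s; split=> //; apply/eqP; rewrite eqEsubv subvf /=.
  by have <- := span_basis (vbasisP (fullv : {vspace g})); apply/span_subvP.
elim: (vbasis _ : seq g) => [|z t [s [ns ts]]]; first by exists [::].
have [s' [ns' zs']] := allSp z; exists (s' ++ s); split; first exact: cat_nil.
move=> w; rewrite inE => /orP[/eqP->|wt]; apply: cat_sub; first by left.
by right; apply: ts.
Qed.
End NilpotentGenerators.

(** * Filtration of the module by word length *)

Section WordFiltration.
Variables (F : numClosedFieldType) (g : finLieAlgType F) (M : lieModType g).
Variables (s : seq g) (K : nat) (v : M).
Hypotheses (s_span : <<s>>%VS = fullv)
  (s_nil : forall x, x \in s -> forall m : M, iter K (lact x) m = 0).
Implicit Types (w : seq g) (m : M).

Definition wact w : M := foldr (@lact F g M) v w.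

Inductive filt (d : nat) : M -> Prop :=
| filt0 : filt d 0
| filt_lin a u u' : filt d u -> filt d u' -> filt d (a *: u + u')
| filt_word w : all (mem s) w -> (size w < d)%N -> filt d (wact w).

Lemma filt_le d d' m : (d <= d')%N -> filt d m -> filt d' m.
Proof.
move=> dd'; elim=> [|a u u' _ fu _ fu'|w ws wd]; first exact: filt0.
  exact: filt_lin.
by apply: filt_word => //; apply: leq_trans dd'.
Qed.

Lemma filtD d m m' : filt d m -> filt d m' -> filt d (m + m').
Proof. by move=> fm fm'; rewrite -[m]scale1r; apply: filt_lin. Qed.

Lemma filtZ d a m : filt d m -> filt d (a *: m).
Proof. by move=> fm; rewrite -[_ *: _]addr0; apply: filt_lin fm (filt0 _). Qed.

Lemma filt_lact_gen d x m : x \in s -> filt d m -> filt d.+1 (lact x m).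
Proof.
move=> xs; elim=> [|a u u' _ fu _ fu'|w ws wd].
- by rewrite linear0; apply: filt0.
- by rewrite linearP; apply: filt_lin.
- by apply: (@filt_word _ (x :: w)) => //; apply/andP.
Qed.

Lemma filt_lact d x m : filt d m -> filt d.+1 (lact x m).
Proof.
move=> fm; have xs : x \in <<in_tuple s>>%VS by rewrite [<<_>>%VS]s_span memvf.
rewrite (coord_span xs) lact_suml; elim/big_ind: _ => [||i _]; first exact: filt0.
  by move=> m1 m2; apply: filtD.
by rewrite lactZl; apply/filtZ/filt_lact_gen => //; rewrite mem_nth.
Qed.

(* Commuting a letter to the front of a word costs only shorter words. *)
Lemma filt_front x w1 w2 : all (mem s) (w1 ++ x :: w2) ->
  filt (size (w1 ++ w2)).+1 (wact (w1 ++ x :: w2) - wact (x :: w1 ++ w2)).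
Proof.
elim: w1 => [|y w1 IH] /=; first by rewrite subrr => _; apply: filt0.
move=> /andP[ys aw]; have fw := IH aw.
have ws : all (mem s) (w1 ++ w2) by move: aw; rewrite !all_cat /= => /and3P[-> _ ->].
rewrite -/(wact _) -/(wact (w1 ++ w2)) [lact x (lact y _)]lact_swap opprD addrCA addrC.
apply: filtD; first by rewrite -linearB; apply: filt_lact.
by rewrite -scaleN1r; apply/filtZ/filt_lact/filt_word.
Qed.

(** Modulo shorter words, [j] copies of a letter are gathered in front; with [j] equal to [K] the
    gathered power is 0 on [M], so the word itself becomes shorter. *)
Lemma filt_pull x j w : all (mem s) w -> (j <= count_mem x w)%N ->
  exists w', [/\ all (mem s) w', (size w' + j)%N = size w &
    filt (size w) (wact w - iter j (lact x) (wact w'))].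
Proof.
elim: j w => [|j IH] w ws jw.
  by exists w; rewrite addn0 subrr; split=> //; apply: filt0.
have xw : x \in w by rewrite -has_pred1 has_count (leq_trans _ jw).
case/splitPr: xw ws jw => w1 w2 ws jw.
have ws' : all (mem s) (w1 ++ w2) by move: ws; rewrite !all_cat /= => /and3P[-> _ ->].
have sz : size (w1 ++ x :: w2) = (size (w1 ++ w2)).+1 by rewrite !size_cat addnS.
have [|w' [w's sw' fw']] := IH _ ws'.
  by move: jw; rewrite !count_cat /= eqxx addnCA add1n ltnS.
exists w'; split=> //; first by rewrite sz addnS sw'.
rewrite sz -[X in filt _ X](subrKA (wact (x :: w1 ++ w2))).
apply: filtD; first exact: filt_front.
by rewrite -linearB /=; apply: filt_lact.
Qed.

Lemma pigeonhole_word w : all (mem s) w -> (size s * K < size w)%N ->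
  exists2 x, x \in s & (K <= count_mem x w)%N.
Proof.
move=> ws wK; apply: contrapT => nex.
have : (size w <= \sum_(x <- s) count_mem x w)%N.
  (* Only an inequality, because [s] may list an element several times. *)
  elim: w ws {wK nex} => // y w IH /andP[ys /IH le].
  rewrite /= big_split /= -add1n leq_add //.
  by rewrite (big_rem y) //= eqxx.
rewrite leqNgt => /negP; apply; apply: leq_ltn_trans wK.
rewrite -sum1_size big_distrl /= big_seq [X in (_ <= X)%N]big_seq.
apply: leq_sum => x xs; rewrite mul1n ltnW // ltnNge; apply/negP => Kx.
by apply: nex; exists x.
Qed.

Lemma filt_bound d m : filt d m -> filt (size s * K).+1 m.
Proof.
elim: d m => [|d IH] m; first exact: filt_le.
have [dK|Kd] := leqP d (size s * K)%N; first exact: filt_le.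
move=> fm; apply: IH; elim: fm => [|a u u' _ fu _ fu'|w ws]; first exact: filt0.
  exact: filt_lin.
rewrite ltnS leq_eqVlt => /orP[/eqP wd|wd]; last exact: filt_word.
have [|x xs xK] := pigeonhole_word ws; first by rewrite wd.
have [w' [_ _]] := filt_pull ws xK.
by rewrite s_nil // subr0 wd.
Qed.

Fixpoint words d : seq (seq g) :=
  if d is d'.+1 then [::] :: [seq x :: w | x <- s, w <- words d'] else [::].

Lemma mem_words d w : all (mem s) w -> (size w < d)%N -> w \in words d.
Proof.
elim: d w => // d IH [|x w] /= ws wd; first exact: mem_head.
have /andP[xs ws'] := ws; rewrite inE; apply/orP; right.
by apply: allpairs_f => //; apply: IH.
Qed.

(** By [filt_bound] the step [D] of the filtration absorbs the action of g, so it is a submodule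
    containing [v]; the words of length below [D] are finitely many. *)
Lemma cyclic_finitely_generated : simple_lie_module M -> v != 0 ->
  finitely_generated (M : lmodType F).
Proof.
move=> M_simple v0; set D := (size s * K).+1.
have allD m : filt D m.
  have [|N0|//] := M_simple.2 (filt D).
    split; [exact: filt0|by move=> a u u'; apply: filt_lin|].
    by move=> x u /(filt_lact x)/filt_bound.
  by case/eqP: v0; apply: N0; apply: (@filt_word D [::]).
exists [seq wact w | w <- words D] => m; set S := map _ _.
elim: (allD m) => [|a u u' _ [c1 ->] _ [c2 ->]|w ws wD].
- by exists (fun=> 0); rewrite big1 // => i _; rewrite scale0r.
- exists (fun i => a * c1 i + c2 i); rewrite scaler_sumr -big_split /=.
  by apply: eq_bigr => i _; rewrite scalerDl scalerA.
have wS : wact w \in S by apply/map_f/mem_words.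
have iS : (index (wact w) S < size S)%N by rewrite index_mem.
exists (fun i => (i == index (wact w) S)%:R).
rewrite (bigD1 (Ordinal iS)) //= eqxx scale1r nth_index // big1 ?addr0 // => i.
by rewrite -val_eqE /= => /negPf ->; rewrite scale0r.
Qed.

End WordFiltration.

Section CartanAction.
Variables (F : numClosedFieldType) (g : finLieAlgType F) (h : lieSubalg g)
  (M : lieModType g).
Local Notation hh := (h : {vspace g}).
Hypothesis h_abelian : forall x y, x \in hh -> y \in hh -> bracket x y = 0.

Definition cartan_basis (i : 'I_(\dim h)) : g := (vbasis h)`_i.

Definition cartan_basis_sub i : subvs_of h := vsproj h (cartan_basis i).

Lemma cartan_basis_mem i : cartan_basis i \in hh.
Proof. by apply: vbasis_mem; rewrite mem_nth ?size_tuple. Qed.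

Lemma cartan_basis_free (x : 'I_(\dim h) -> F) :
  \sum_j x j *: cartan_basis j = 0 -> forall j, x j = 0.
Proof. exact/freeP/(basis_free (vbasisP h)). Qed.

Lemma subvs_abelian (x y : subvs_of h) : bracket x y = 0.
Proof. by apply/val_inj/h_abelian; apply: subvsP. Qed.

Lemma cartan_basis_span (x : subvs_of h) :
  exists c : 'I_(\dim h) -> F, x = \sum_i c i *: cartan_basis_sub i.
Proof.
exists (fun i => coord (vbasis h) i (vsval x)); apply: val_inj.
rewrite [LHS](coord_vbasis (subvsP x)) linear_sum; apply: eq_bigr => i _.
by rewrite linearZ /= vsprojK ?cartan_basis_mem.
Qed.

Definition pact (p : {mpoly F[\dim h]}) (m : M) : M :=
  uact (uev cartan_basis_sub p) (m : resMod h M).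

Lemma pactD p q m : pact (p + q) m = pact p m + pact q m.
Proof. by rewrite /pact uevD uactDl. Qed.

Lemma pactC c m : pact c%:MP m = c *: m.
Proof. by rewrite /pact uevC uactZ uact1. Qed.

Lemma pactX i p m : pact ('X_i * p) m = lact (cartan_basis i) (pact p m).
Proof.
rewrite /pact (uevX _ subvs_abelian) -uactA uact_iota -[LHS]/(lact (vsval _) _).
by rewrite vsprojK ?cartan_basis_mem.
Qed.

Lemma pact_lin p : linear (pact p).
Proof.
move=> a u v; exact: (uact_linearr (M := resMod h M) (uev cartan_basis_sub p) a u v).
Qed.
End CartanAction.

Theorem corollary3p12 (R : realType) (g : finLieAlgType R[i])
    (h : lieSubalg g) (M : lieModType g) :
  simple_lie g ->
  cartan_subalgebra h ->
  simple_lie_module M ->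
  ~ finitely_generated (M : lmodType R[i]) ->
  finitely_generated (uenvMod (resMod h M) : lmodType (uenv (subvs_of h))) ->
  torsion_free (uenvMod (resMod h M) : lmodType (uenv (subvs_of h))).
Proof.
move=> g_simple h_cartan M_simple M_inf [s s_gen] a v av0.
have [a0|a0] := pselect (a = 0); [by left|right].
apply: contrapT => /eqP v0.
have [h_abelian [k [pr [al [pr_sum pr_wt pr_neq0]]]]] :=
  root_decomposition g_simple h_cartan.
have uev_onto := uev_surj (subvs_abelian h_abelian) (@cartan_basis_span _ _ h).
have M_fg : exists s : seq M, forall m, exists c : nat -> {mpoly R[i][\dim h]},
    m = \sum_(i < size s) pact (c i) s`_i.
  exists s => m; have [c mE] := s_gen m.
  have [q qE] := choice (fun i => uev_onto (c i)).
  exists q; rewrite [LHS]mE; apply: eq_bigr => i _.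
  by rewrite /pact -qE.
have [p aE] := uev_onto a.
(* The polynomial 0 evaluates to 0, so any lift of the nonzero [a] is nonzero; the torsion relation
   is from here on a statement about polynomials. *)
have p0 : p != 0.
  apply/negP => /eqP p0; apply: a0; rewrite aE p0 -mpolyC0 uevC; exact: scale0r.
have pv : pact p (v : M) = 0 by rewrite /pact -aE.
have [e [e0 ade eM]] := exists_nilpotent_root_vector (@cartan_basis_mem _ _ h)
  (@cartan_basis_free _ _ h) (@pactD _ _ h M) (@pactC _ _ h M)
  (pactX h_abelian) (@pact_lin _ _ h M) g_simple M_simple pr_sum pr_wt M_fg
  pr_neq0 p0 v0 pv.
have [t [tM t_span]] := nilpotent_span g_simple h_cartan.2 pr_sum pr_wt
  e0 ade eM.
have [K tK] : exists K, forall x, x \in t -> forall m : M, iter K (lact x) m = 0.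
  elim: t tM {t_span} => [|x t IH] tM; first by exists 0.
  have [|K tK] := IH; first by move=> y yt; apply: tM; rewrite inE yt orbT.
  have [j xj] := tM x (mem_head _ _); exists (K + j)%N => y.
  rewrite inE => /orP[/eqP->|yt] m.
    exact: iter_lact_ge (leq_addl _ _) (xj m).
  exact: iter_lact_ge (leq_addr _ _) (tK y yt m).
exact/M_inf/(cyclic_finitely_generated t_span tK M_simple v0).
Qed.
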